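(* Let $X$ be a $q$-homogeneous tree with $q\ge 2$, let $a,b\in\mathbb{R}$, and let $\alpha>1$, $c>1$ and $1<p<\infty$. The following conditions are equivalent: (i) the operator $S_{a,b,c}$ is bounded on $L^p_\alpha$; (ii) the operator $T_{a,b,c}$ is bounded on $L^p_\alpha$; (iii) the parameters satisfy $$c\le a+b,\qquad -pa<\alpha-1<p(b-1).$$
   Context: A $q$-homogeneous tree $X$ ($q\ge 2$ an integer) is an undirected connected cycle-free graph in which every vertex has exactly $q+1$ neighbours; $X$ also denotes its vertex set, $o\in X$ is a fixed origin and $|x|$ is the graph distance of $x$ from $o$. A function $f:X\to\mathbb{C}$ is harmonic if $f(v)=\frac1{q+1}\sum_{u\sim v}f(u)$ for every $v\in X$, where $u\sim v$ means adjacency. For $\alpha>1$, $\mu_\alpha$ is the finite measure on $X$ with density $\mu_\alpha(x)=q^{-\alpha|x|}$ with respect to the counting measure. $L^p_\alpha$ is the space of $f:X\to\mathbb{C}$ with $\|f\|_{L^p_\alpha}^p=\sum_{x\in X}|f(x)|^pq^{-\alpha|x|}<\infty$. For $c>1$, $\mathcal{A}^2_c$ is the Hilbert space of harmonic functions in $L^2_c$ (scalar product $\sum_x f(x)\overline{g(x)}q^{-c|x|}$), which is a reproducing kernel Hilbert space, and $K_c:X\times X\to\mathbb{R}$ denotes its reproducing kernel: $K_c(z,\cdot)\in\mathcal{A}^2_c$ and $\sum_x g(x)K_c(z,x)q^{-c|x|}=g(z)$ for all $g\in\mathcal{A}^2_c$, $z\in X$. For $a,b\in\mathbb{R}$ and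 $c>1$ the integral operators $S_{a,b,c}$ and $T_{a,b,c}$ are $$S_{a,b,c}f(z)=q^{-a|z|}\sum_{x\in X}|K_c(z,x)|f(x)q^{-b|x|},\qquad T_{a,b,c}f(z)=q^{-a|z|}\sum_{x\in X}K_c(z,x)f(x)q^{-b|x|}.$$ *)

(* Defs.v *)
From HB Require Import structures.
From mathcomp Require Import all_boot all_order all_algebra.
From mathcomp Require Import all_classical all_reals all_analysis.
From mathcomp Require Export complex.
Set Implicit Arguments.
Unset Strict Implicit.
Unset Printing Implicit Defensive.
Import Order.TTheory GRing.Theory Num.Theory.

Local Open Scope classical_set_scope.
Local Open Scope ring_scope.
Local Open Scope complex_scope.

Section Tree.
Variables (X : choiceType) (E : rel X).

(* Acyclicity: an edge traversed back and forth is a [ucycle] of size 2, so the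
   genuine cycles are the duplicate-free ones with at least 3 vertices. *)
Definition homogeneous_tree (q : nat) : Prop :=
  [/\ symmetric E,
      irreflexive E,
      forall x y, exists2 s, path E x s & last x s = y,
      forall s, ucycle E s -> (size s <= 2)%N &
      forall v, ([set u | E v u] #= `I_q.+1)%card].

Definition walkb (x y : X) (n : nat) : bool :=
  `[< exists s, [/\ path E x s, last x s = y & size s = n] >].

(* The value 0 for disconnected vertices is never used in a connected graph. *)
Definition gdist (x y : X) : nat :=
  if pselect (exists n, walkb x y n) is left xy then ex_minn xy else 0%N.

End Tree.

Section Sums.
Variables (R : realType) (X : choiceType).

Definition csummable (h : X -> R[i]) : Prop :=
  summable setT (fun x => (Normc.normc (h x))%:E).

(* Meaningful for absolutely summable families: difference of the sums of the
   positive and the negative part. *)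
Definition rsum (u : X -> R) : R :=
  fine (esum setT (EFin \o u)^\+%E - esum setT (EFin \o u)^\-%E)%E.

Definition csum (h : X -> R[i]) : R[i] :=
  rsum (fun x => complex.Re (h x)) +i* rsum (fun x => complex.Im (h x)).

End Sums.

Section Spaces.
Variables (R : realType) (X : choiceType) (E : rel X) (o : X) (q : nat).
Implicit Types (a b c alpha p : R) (f g : X -> R[i]) (k K : X -> X -> R).

Definition weight a (x : X) : R := q%:R `^ (- (a * (gdist E o x)%:R)).

Definition harmonic f : Prop :=
  forall v, f v = (q.+1%:R)^-1 * \sum_(u \in [set u | E v u]) f u.

Definition Lp_esum alpha p f : \bar R :=
  \esum_(x in setT) ((Normc.normc (f x)) `^ p * weight alpha x)%:E.

Definition inLp alpha p f : Prop := (Lp_esum alpha p f < +oo)%E.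

Definition Lp_norm alpha p f : R := (fine (Lp_esum alpha p f)) `^ p^-1.

Definition bergman c f : Prop := harmonic f /\ inLp c 2 f.

Definition reproducing_kernel c K : Prop :=
  (forall z, bergman c (fun x => (K z x)%:C)) /\
  (forall g z, bergman c g ->
     csum (fun x => g x * (K z x)%:C * (weight c x)%:C) = g z).

Lemma reproducing_kernel_uniq c K1 K2 :
  reproducing_kernel c K1 -> reproducing_kernel c K2 -> K1 = K2.
Proof.
have swap K K' : reproducing_kernel c K -> reproducing_kernel c K' ->
    forall z w, K z w = K' w z.
  move=> [KA KE] [KA' KE'] z w.
  have H1 := KE' _ w (KA z); have H2 := KE _ z (KA' w).
  have [//] : (K z w)%:C = (K' w z)%:C.
  by rewrite -H1 -H2; congr csum; apply/funext => x; rewrite [_%:C * _]mulrC.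
move=> h1 h2; apply/funext => z; apply/funext => w.
by rewrite (swap _ _ h1 h2) (swap _ _ h2 h2).
Qed.

(* The reproducing kernel K_c, chosen among the functions with the defining
   property; by [reproducing_kernel_uniq] there is no other candidate. *)
Definition bergman_kernel c : X -> X -> R :=
  xget (fun _ _ => 0) [set K : X -> X -> R | reproducing_kernel c K].

Definition kernel_op k a b f (z : X) : R[i] :=
  (weight a z)%:C * csum (fun x => (k z x)%:C * f x * (weight b x)%:C).

(* Boundedness includes that the series defining the operator converges
   absolutely at every point, for every f in the space. *)
Definition bounded_kernel_op alpha p k a b : Prop :=
  exists C : R, forall f, inLp alpha p f ->
    [/\ forall z, csummable (fun x => (k z x)%:C * f x * (weight b x)%:C),
        inLp alpha p (kernel_op k a b f) &
        Lp_norm alpha p (kernel_op k a b f) <= C * Lp_norm alpha p f].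

Definition S_bounded a b c alpha p : Prop :=
  bounded_kernel_op alpha p (fun z x => `|bergman_kernel c z x|) a b.

Definition T_bounded a b c alpha p : Prop :=
  bounded_kernel_op alpha p (bergman_kernel c) a b.

End Spaces.

(* Main.v *)
Require Import Defs.
From mathcomp Require Import all_boot all_order all_algebra.
From mathcomp Require Import all_classical all_reals all_analysis.
From mathcomp Require Import zify ring lra.
Import Order.TTheory GRing.Theory Num.Theory.
Import numFieldNormedType.Exports.
Local Open Scope ring_scope.

(** The proof rests on an explicit formula for the reproducing kernel [K] of the
    space of harmonic functions with weight [q ^ (- c |x|)].

    The distance to [o] turns the tree into a rooted tree.  For a vertex [u]
    with parent [v], the function [green u] that vanishes outside the descendants
    of [u] and equals [1 + 1/q + ... + q ^ (- d)] on those of depth [d] below [u]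
    has Laplacian [1] at [v] and [0] elsewhere.  Subtracting from it the
    average of the same functions over all children of [v] therefore gives a
    harmonic function, [mode u].  The sum of a harmonic [g] over the
    descendants of [u] of a given depth is an affine combination of [g v] and
    [g u] (lemma [sum_generation_harmonic]), so that the pairing of [g] with
    [mode u] over a ball is an explicit multiple of [g u - g v] minus a
    [q]-th of the previous increment of [g] (lemma [sum_ball_mode]).  With
    [z_0 = o, ..., z_n = z] the geodesic from [o] to [z], the right combination
    of a constant and of [mode z_1, ..., mode z_n] then reproduces [g z] by a
    telescoping sum (lemma [sum_ball_kernel_cvg]); by uniqueness it is the
    Bergman kernel (lemma [bergman_kernelE]).

    Three features of [K] are read off the formula: [K o x] and [K x o] are a
    positive constant; [K x x] is at least a constant times [q ^ (c |x|)];
    and [|K z x|] is at most a constant times [confluence z x], the sum of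
    [q ^ (c i)] over the levels [i] at which [z] and [x] have a common
    ancestor.  They hold for [|K|] as well, and for every kernel [k] with these
    features boundedness of the operator is equivalent to the stated inequalities
    on the parameters (lemma [bounded_kernel_opP]).

    Necessity: the point mass at [o] is mapped to a constant multiple of
    [q ^ (- a |z|)], whose membership in the space gives [- p a < alpha - 1]; the
    value at [x] of the image of the point mass at [x] gives [c <= a + b]; the
    value at [o] of the image of [q ^ (|x| (alpha - 1) / p)] cut off at radius
    [M] gives [alpha - 1 < p (b - 1)], as it would otherwise be at least of order
    [M] for a function of norm at most of order [M ^ (1 / p)], and [p > 1].

    Sufficiency: since [c <= a + b], the factor [q ^ (c i)] may be replaced by
    [q ^ ((a + b) i)].  The number of descendants of depth [d] of a
    vertex is at most [2 q ^ d], so sums of [confluence z x * q ^ (s |x|)] over [x] are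
    geometric and bounded by [q ^ ((a + b + s) |z|)] as soon as
    [s < -1] and [a + b + s > 0].  Schur's test with [q ^ (tau |x|)] applies when
    four such inequalities on [tau] hold, and by the assumptions on the parameters
    the two intervals they describe intersect.  The test is run on finite balls, and
    the balls are exhausted at the end. *)
Set Implicit Arguments.
Unset Strict Implicit.
Unset Printing Implicit Defensive.

(** * Levels, parents and children in a homogeneous tree *)

(** The combinatorial interface on which everything after the first part rests.
    [par o] is unconstrained: [o] has no parent, and accordingly [mem_ch]
    excludes it from every list of children. *)
Record rooted_tree (q : nat) (X : choiceType) (o : X) (lvl : X -> nat)
    (par : X -> X) (ch : X -> seq X) : Prop := RootedTree {
  lvl_root : lvl o = 0%N;
  lvl_eq_root : forall x, lvl x = 0%N -> x = o;
  lvl_par : forall x, x != o -> lvl x = (lvl (par x)).+1;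
  mem_ch : forall u v, (u \in ch v) = (u != o) && (par u == v);
  ch_uniq : forall v, uniq (ch v);
  size_ch : forall v, size (ch v) = (q + (v == o))%N
}.

Section Levels.
Variables (q : nat) (X : choiceType) (E : rel X) (o : X).
Hypothesis hX : homogeneous_tree E q.

Definition lvl (x : X) : nat := gdist E o x.

Lemma lvl_path x : exists s, [/\ path E o s, last o s = x & size s = lvl x].
Proof.
case: hX => _ _ conn _ _; rewrite /lvl /gdist; case: pselect => [h|].
  by case: ex_minnP => n /asboolP.
case; have [s sp sl] := conn o x; exists (size s); apply/asboolP.
by exists s.
Qed.

Lemma lvl_le s : path E o s -> (lvl (last o s) <= size s)%N.
Proof.
move=> sp; rewrite /lvl /gdist; case: pselect => [h|//].
by case: ex_minnP => n _; apply; apply/asboolP; exists s.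
Qed.

Lemma lvl_o : lvl o = 0%N.
Proof. by apply/eqP; rewrite -leqn0 (@lvl_le [::]). Qed.

Lemma lvl_eq0 x : lvl x = 0%N -> x = o.
Proof. by case: (lvl_path x) => -[|y s] [_ <- <-]. Qed.

Lemma lvl_edge x y : E x y -> (lvl y <= (lvl x).+1)%N.
Proof.
have [s [sp sl ss]] := lvl_path x => xy.
have <- : last o (rcons s y) = y by rewrite last_rcons.
by rewrite -ss -(size_rcons s y) lvl_le // rcons_path sp sl.
Qed.

(** A shortest path from [o] to [y] can only meet a vertex [x <> y] that lies
    strictly closer to [o] than [y]. *)
Lemma avoiding_path x y : (lvl y <= lvl x)%N -> y != x ->
  exists s, [/\ path E o s, last o s = y & x \notin (o :: s)].
Proof.
move=> yx ynx; have [s [sp sl ss]] := lvl_path y; exists s; split => //.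
apply/negP => xs; case/splitPl: xs sp sl ss => s1 s2 s1x.
rewrite cat_path last_cat size_cat => /andP[sp1 _] s2y ss.
have := lvl_le sp1; rewrite s1x => xs1.
have : (size s2 <= 0)%N.
  by rewrite -(leq_add2l (size s1)) addn0 ss (leq_trans yx).
by rewrite leqn0 => /eqP/size0nil s20; move: ynx; rewrite -s2y s20 /= s1x eqxx.
Qed.

(** In an acyclic graph, a walk that joins two distinct neighbours of [x] and
    avoids [x] would close up to a cycle through [x].  Going from one
    neighbour to [o] and back to the other gives such a walk. *)
Lemma unique_low_neighbour x y1 y2 : E x y1 -> E x y2 ->
  (lvl y1 <= lvl x)%N -> (lvl y2 <= lvl x)%N -> y1 = y2.
Proof.
case: hX => Es Ei _ cyc _ e1 e2 l1 l2.
have n1 : y1 != x by apply: contraTneq e1 => ->; rewrite Ei.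
have n2 : y2 != x by apply: contraTneq e2 => ->; rewrite Ei.
have [s1 [p1 t1 a1]] := avoiding_path l1 n1.
have [s2 [p2 t2 a2]] := avoiding_path l2 n2.
have pr : path E y1 (rev (belast o s1) ++ s2).
  rewrite -t1 cat_path rev_path; apply/andP; split.
    by rewrite (eq_path (e' := E)) // => u v; rewrite Es.
  suff -> : last (last o s1) (rev (belast o s1)) = o by [].
  by case: (s1) => //= z s; rewrite rev_cons last_rcons.
have lr : last y1 (rev (belast o s1) ++ s2) = y2.
  rewrite last_cat -t2 -t1; congr last.
  by case: (s1) => //= z s; rewrite rev_cons last_rcons.
have ar : x \notin y1 :: rev (belast o s1) ++ s2.
  rewrite inE mem_cat mem_rev !negb_or eq_sym n1 /=.
  move: a1 a2; rewrite lastI mem_rcons !inE !negb_or => /andP[_ ->] /=.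
  by case/andP.
case/shortenP: pr lr ar => s sp su ss lr ar.
apply: contraTeq isT => n12.
have /cyc : ucycle E [:: x, y1 & s].
  apply/andP; rewrite /= rcons_path e1 sp lr Es e2 /=.
  rewrite -[_ && uniq s]/(uniq (y1 :: s)) su andbT.
  split=> //; apply: contra ar; rewrite !inE; case/orP => [->//|/ss ->].
  by rewrite orbT.
by case: (s) lr n12 => //= ->; rewrite eqxx.
Qed.

(** Two adjacent vertices on the same level would give one of them two low
    neighbours: the other one, and its predecessor on a shortest path from [o]. *)
Lemma lvl_edge_neq x y : E x y -> lvl x != lvl y.
Proof.
case: hX => Es Ei _ _ _ exy; apply/eqP => lxy.
have [s [sp sl ss]] := lvl_path x.
(* The last edge of a shortest path from [o] to [x] provides a second low
   neighbour. *)
case/lastP: s sp sl ss => [|s z].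
  move=> _ _ /= l0; move: exy.
  by rewrite (@lvl_eq0 x) // (@lvl_eq0 y) ?Ei // -lxy.
rewrite rcons_path last_rcons size_rcons => /andP[sp ez] zx ss.
have lz := lvl_le sp.
have ezx : E x (last o s) by rewrite Es -zx.
have := @unique_low_neighbour x y (last o s) exy ezx; rewrite lxy => h.
have yl : y = last o s by apply: h; rewrite // -lxy -ss ltnW.
by move: lz; rewrite -yl -lxy -ss ltnn.
Qed.

Definition nbr (v : X) : seq X :=
  finmap.enum_fset (fset_set [set u | E v u]%classic).

Lemma nbrs_finite v : finite_set [set u | E v u]%classic.
Proof. by case: hX => _ _ _ _ /(_ v) h; exists q.+1. Qed.

Lemma mem_nbr v u : (u \in nbr v) = E v u.
Proof.
rewrite /nbr [LHS](in_fset_set (@nbrs_finite v)).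
by apply/idP/idP; rewrite inE.
Qed.

Lemma size_nbr v : size (nbr v) = q.+1.
Proof. by apply: card_fset_set; case: hX. Qed.

Lemma nbr_uniq v : uniq (nbr v).
Proof. exact: finmap.fset_uniq. Qed.

Definition par (x : X) : X := head o [seq y <- nbr x | lvl y < lvl x]%N.
Definition ch (x : X) : seq X := [seq y <- nbr x | lvl x < lvl y]%N.

Lemma par_low x : x != o -> E x (par x) /\ (lvl (par x) < lvl x)%N.
Proof.
case: hX => Es _ _ _ _ xo.
suff : par x \in [seq y <- nbr x | (lvl y < lvl x)%N].
  by rewrite mem_filter mem_nbr => /andP[].
have [s [sp sl ss]] := lvl_path x; case/lastP: s sp sl ss => [|s z].
  by move=> _ /= ox; rewrite ox eqxx in xo.
rewrite rcons_path last_rcons size_rcons => /andP[sp ez] zx ss.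
have : last o s \in [seq y <- nbr x | (lvl y < lvl x)%N].
  by rewrite mem_filter mem_nbr -{2}zx Es ez -ss ltnS lvl_le.
by rewrite /par; case: [seq _ <- _ | _] => //= a l _; rewrite mem_head.
Qed.

Lemma par_unique x y : E x y -> (lvl y < lvl x)%N -> x != o /\ par x = y.
Proof.
move=> exy yx; have xo : x != o by apply: contraTneq yx => ->; rewrite lvl_o.
have [ep pl] := par_low xo; split=> //.
by apply: unique_low_neighbour ep exy (ltnW pl) (ltnW yx).
Qed.

Lemma perm_nbr v : perm_eq (nbr v) (if v == o then ch v else par v :: ch v).
Proof.
case: (eqVneq v o) => [->|vo]; apply: uniq_perm; rewrite ?nbr_uniq //.
- by rewrite filter_uniq ?nbr_uniq.
- move=> u; rewrite mem_filter lvl_o mem_nbr lt0n.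
  apply/esym/andb_idl => eu; have := lvl_edge_neq eu.
  by rewrite lvl_o eq_sym.
- rewrite /= filter_uniq ?nbr_uniq // andbT mem_filter negb_and -leqNgt.
  by rewrite ltnW //; have [] := par_low vo.
- move=> u; have [ep pl] := par_low vo.
  rewrite inE mem_filter mem_nbr; apply/idP/orP => [eu|[/eqP->//|/andP[]//]].
  case: (ltnP (lvl v) (lvl u)) => h; first by right; rewrite eu.
  left; rewrite eq_sym; apply/eqP.
  by apply: unique_low_neighbour ep eu (ltnW pl) h.
Qed.

Lemma rooted_tree_homogeneous : rooted_tree q o lvl par ch.
Proof.
have Es : symmetric E by case: hX.
split => // [|x /lvl_eq0 //|x xo|u v|v|v].
- exact: lvl_o.
- have [ep pl] := par_low xo.
  by apply/eqP; rewrite eqn_leq pl (@lvl_edge (par x) x) // Es.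
- rewrite mem_filter mem_nbr; apply/andP/andP => [[vu]|[uo /eqP <-]].
    by rewrite Es => /par_unique/(_ vu)[-> ->].
  by have [ep pl] := par_low uo; rewrite Es.
- by rewrite filter_uniq ?nbr_uniq.
- have /perm_size := perm_nbr v; rewrite size_nbr.
  by case: eqP => /= _; [move=> <-; rewrite addn1|case=> <-; rewrite addn0].
Qed.

Lemma sum_neighbours (V : nmodType) (F : X -> V) v :
  \sum_(u \in [set u | E v u]%classic) F u =
  \sum_(u <- ch v) F u + (if v == o then 0 else F (par v)).
Proof.
rewrite fsbig_finite; last exact: nbrs_finite.
rewrite -/(nbr v) (perm_big _ (perm_nbr v)).
by case: eqP => _; rewrite ?addr0 // big_cons addrC.
Qed.

End Levels.

(** * Ancestors and generations in a rooted tree *)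

Lemma sum_seq_const (V : pzSemiRingType) (I : eqType) (s : seq I) (F : I -> V) a :
  {in s, forall i, F i = a} -> \sum_(i <- s) F i = (size s)%:R * a.
Proof.
move=> Fa; rewrite big_seq (eq_bigr _ Fa) -big_seq big_const_seq count_predT.
by rewrite iter_addr_0 mulr_natl.
Qed.

Section RootedTree.
Variables (q : nat) (X : choiceType) (o : X) (lvl : X -> nat) (par : X -> X).
Variable ch : X -> seq X.
Hypothesis T : rooted_tree q o lvl par ch.

Definition anc i x := iter (lvl x - i) par x.

Definition above u x := (lvl u <= lvl x)%N && (anc (lvl u) x == u).

Definition generation u d : seq X :=
  iter d (fun s => flatten [seq ch x | x <- s]) [:: u].

Definition subtree u N : seq X := flatten [seq generation u d | d <- iota 0 N].

Lemma ch_neq_root u v : u \in ch v -> u != o.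
Proof. by rewrite (mem_ch T) => /andP[]. Qed.

Lemma ch_par u v : u \in ch v -> par u = v.
Proof. by rewrite (mem_ch T) => /andP[_ /eqP]. Qed.

Lemma lvl_ch u v : u \in ch v -> lvl u = (lvl v).+1.
Proof. by move=> uv; rewrite (lvl_par T (ch_neq_root uv)) (ch_par uv). Qed.

Lemma lvl_iter_par d x : (d <= lvl x)%N -> lvl (iter d par x) = (lvl x - d)%N.
Proof.
elim: d => [|d IH] dx; first by rewrite subn0.
have := IH (ltnW dx); rewrite iterS => e; rewrite subnS -e.
rewrite [in RHS](lvl_par T) //; apply: contraTneq dx => h.
by move: e; rewrite h (lvl_root T) => /esym/eqP; rewrite subn_eq0 -leqNgt.
Qed.

Lemma lvl_anc i x : (i <= lvl x)%N -> lvl (anc i x) = i.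
Proof. by move=> ix; rewrite /anc lvl_iter_par ?leq_subr // subKn. Qed.

Lemma anc_lvl x : anc (lvl x) x = x.
Proof. by rewrite /anc subnn. Qed.

Lemma anc0 x : anc 0 x = o.
Proof. by apply: (lvl_eq_root T); rewrite lvl_anc. Qed.

Lemma par_anc i x : (i < lvl x)%N -> par (anc i.+1 x) = anc i x.
Proof.
by move=> ix; rewrite /anc -iterS -(subnSK ix).
Qed.

Lemma anc_neq_root i x : (i < lvl x)%N -> anc i.+1 x != o.
Proof.
by move=> ix; apply/eqP => /(congr1 lvl); rewrite lvl_anc // (lvl_root T).
Qed.

Lemma above_anc i x : (i <= lvl x)%N -> above (anc i x) x.
Proof. by move=> ix; rewrite /above lvl_anc // ix eqxx. Qed.

Lemma above_refl x : above x x.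
Proof. by rewrite /above leqnn anc_lvl eqxx. Qed.

Lemma above_root x : above o x.
Proof. by rewrite /above (lvl_root T) anc0 eqxx. Qed.

Lemma above_ancE i z x : (i <= lvl z)%N ->
  above (anc i z) x = (i <= lvl x)%N && (anc i x == anc i z).
Proof. by move=> iz; rewrite /above lvl_anc. Qed.

Lemma above_ch u v x : u \in ch v -> above u x -> above v x.
Proof.
move=> uv; have lu := lvl_ch uv; rewrite /above lu => /andP[vx /eqP ux].
by rewrite (ltnW vx) -par_anc // ux (ch_par uv) eqxx.
Qed.

Lemma above_par u x : u != o -> x != o -> x != u -> above u x = above u (par x).
Proof.
move=> uo xo xu; rewrite /above (lvl_par T xo).
case: (ltngtP (lvl u) (lvl (par x)).+1) => [h|h|h].
- have h' : (lvl u <= lvl (par x))%N := h.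
  by rewrite h' /= /anc (lvl_par T xo) subSn // iterSr.
- by rewrite leqNgt (ltn_trans _ h).
- have -> : anc (lvl u) x = x by rewrite h -(lvl_par T xo) anc_lvl.
  by rewrite (negPf xu) h ltnn.
Qed.

Lemma mem_generation u d x :
  (x \in generation u d) = (lvl x == lvl u + d)%N && (iter d par x == u).
Proof.
elim: d x => [|d IH] x.
  rewrite inE addn0; apply/idP/andP => [/eqP->|[]//]; by rewrite !eqxx.
rewrite [generation _ _]/(flatten [seq ch y | y <- generation u d]).
apply/flatten_mapP/andP => [[y]|[lx /eqP ix]].
  rewrite IH => /andP[/eqP ly /eqP iy] xy; rewrite (lvl_ch xy) ly addnS eqxx.
  by rewrite iterSr (ch_par xy) iy eqxx.
have xo : x != o.
  by apply: contraTneq lx => ->; rewrite (lvl_root T) addnS.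
exists (par x); last by rewrite (mem_ch T) xo eqxx.
by rewrite IH -iterSr ix eqxx andbT -eqSS -(lvl_par T xo) (eqP lx) addnS.
Qed.

Lemma generation_uniq u d : uniq (generation u d).
Proof.
elim: d => //= d IH; move: (generation u d) IH => s.
elim: s => //= y s IHs /andP[ys us].
rewrite cat_uniq (ch_uniq T) IHs // andbT /=; apply/hasPn => x /flatten_mapP[z zs xz].
by apply: contra ys => /ch_par <-; rewrite (ch_par xz).
Qed.

Lemma mem_subtree u N x : (x \in subtree u N) = above u x && (lvl x < lvl u + N)%N.
Proof.
apply/flatten_mapP/andP => [[d]|[/andP[ux /eqP ax] xN]].
  rewrite mem_iota add0n leq0n /= mem_generation => dN /andP[/eqP lx /eqP ix].
  by rewrite /above /anc lx leq_addr addKn ix eqxx ltn_add2l.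
exists (lvl x - lvl u)%N; first by rewrite mem_iota; lia.
by rewrite mem_generation -[_ == u]/(anc (lvl u) x == u) ax subnKC // !eqxx.
Qed.

Lemma subtree_uniq u N : uniq (subtree u N).
Proof.
rewrite /subtree; elim: N 0%N => //= N IH m.
rewrite cat_uniq generation_uniq IH andbT /=.
apply/hasPn => x /flatten_mapP[d]; rewrite mem_iota !mem_generation => /andP[md _].
by move=> /andP[/eqP -> _]; rewrite eqn_add2l gtn_eqF.
Qed.

Lemma mem_ball N x : (x \in subtree o N) = (lvl x < N)%N.
Proof. by rewrite mem_subtree above_root (lvl_root T). Qed.

Lemma filter_above_ball u N :
  perm_eq [seq x <- subtree o N | above u x] (subtree u (N - lvl u)).
Proof.
apply: uniq_perm; rewrite ?filter_uniq ?subtree_uniq // => x.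
rewrite mem_filter mem_ball mem_subtree; case: (boolP (above u x)) => //= /andP[ux _].
by apply/idP/idP; lia.
Qed.

Section Sums.
Variable V : nmodType.
Implicit Type F : X -> V.

Lemma sum_subtree u N F :
  \sum_(x <- subtree u N) F x = \sum_(d < N) \sum_(x <- generation u d) F x.
Proof. by rewrite big_flatten big_map -{1}(subn0 N) -/(index_iota 0 N) big_mkord. Qed.

Lemma sum_generationS u d F :
  \sum_(x <- generation u d.+1) F x = \sum_(x <- generation u d) \sum_(y <- ch x) F y.
Proof. by rewrite /generation /= big_flatten big_map. Qed.

(** A generation can be enumerated by its first ancestors below [u] just as well
    as by the parents of its members. *)
Lemma sum_generation_ch u d F :
  \sum_(x <- generation u d.+1) F x = \sum_(v <- ch u) \sum_(x <- generation v d) F x.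
Proof.
elim: d F => [|d IH] F.
  rewrite sum_generationS big_seq1; apply: eq_bigr => v _; by rewrite big_seq1.
rewrite sum_generationS IH; apply: eq_bigr => v _; by rewrite sum_generationS.
Qed.

Lemma sum_ball_above u N F :
  \sum_(x <- subtree o N | above u x) F x = \sum_(x <- subtree u (N - lvl u)) F x.
Proof. by rewrite -big_filter (perm_big _ (filter_above_ball u N)). Qed.

End Sums.

Lemma size_generationS u d :
  size (generation u d.+1) = (\sum_(x <- generation u d) size (ch x))%N.
Proof.
by rewrite -sum1_size sum_generationS; apply: eq_bigr => y _; rewrite sum1_size.
Qed.

Lemma size_generation u d : u != o -> size (generation u d) = (q ^ d)%N.
Proof.
move=> uo; elim: d => // d IH; rewrite size_generationS big_seq.
rewrite (eq_bigr (fun=> q)) => [|x].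
  by rewrite -big_seq big_const_seq count_predT iter_addn_0 IH expnS.
rewrite mem_generation (size_ch T) => /andP[/eqP lx _].
case: eqP => [xo|]; last by rewrite addn0.
case/eqP: uo; apply: (lvl_eq_root T); move: lx; rewrite xo (lvl_root T); lia.
Qed.

(** The root has [q + 1] children and every other vertex [q]. *)
Lemma size_generation_root d : size (generation o d.+1) = (q.+1 * q ^ d)%N.
Proof.
rewrite -sum1_size sum_generation_ch big_seq (eq_bigr (fun=> q ^ d)%N) => [|v vo].
  by rewrite -big_seq big_const_seq count_predT iter_addn_0 (size_ch T) eqxx
    addn1 mulnC.
by rewrite sum1_size size_generation // (ch_neq_root vo).
Qed.

Lemma size_generation_ge u d : (q ^ d <= size (generation u d))%N.
Proof.
case: (eqVneq u o) => [->|uo]; last by rewrite size_generation.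
by case: d => [|d] //; rewrite size_generation_root expnS leq_mul.
Qed.

Lemma size_generation_le u d : (0 < q)%N -> (size (generation u d) <= 2 * q ^ d)%N.
Proof.
move=> q0; case: (eqVneq u o) => [->|uo]; last by rewrite size_generation // leq_pmull.
by case: d => [|d] //; rewrite size_generation_root expnS mulnA leq_mul //; lia.
Qed.

End RootedTree.

(** * Unordered sums as limits along an exhaustion *)

Lemma ler_sum_subset (R : numDomainType) (X : eqType) (s t : seq X) (F : X -> R) :
  uniq s -> uniq t -> {subset s <= t} -> (forall x, 0 <= F x) ->
  \sum_(x <- s) F x <= \sum_(x <- t) F x.
Proof.
move=> us ut st F0; rewrite [leRHS](bigID (mem s)) /= -[X in _ <= X + _]big_filter.
have st' : perm_eq [seq x <- t | x \in s] s.
  apply: uniq_perm; rewrite ?filter_uniq // => x.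
  by rewrite mem_filter; apply: andb_idr => /st.
by rewrite (perm_big _ st') lerDl sumr_ge0.
Qed.

(** Unordered sums are computed as limits over an increasing sequence of finite
    sets; for the tree these will be the balls around the root. *)
Section Exhaustion.
Variables (R : realType) (X : choiceType) (B : nat -> seq X).
Hypothesis B_uniq : forall n, uniq (B n).
Hypothesis B_mono : forall m n, (m <= n)%N -> {subset B m <= B n}.
Hypothesis B_cover : forall x, exists n, x \in B n.
Implicit Types (h u : X -> R) (f : X -> R[i]).

Lemma exhaust_seq (s : seq X) : exists n, {subset s <= B n}.
Proof.
elim: s => [|x s [n sn]]; first by exists 0%N.
have [m xm] := B_cover x; exists (maxn m n) => y; rewrite inE => /predU1P[->|/sn].
  by apply: B_mono xm; rewrite leq_maxl.
by apply: B_mono; rewrite leq_maxr.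
Qed.

Lemma esum_le_exhaust h M : (forall x, 0 <= h x) ->
  (forall n, \sum_(x <- B n) h x <= M) ->
  (esum setT (fun x => (h x)%:E) <= M%:E)%E.
Proof.
move=> h0 hM; apply: ge_ereal_sup => _ [A [fA _] <-].
rewrite fsumEFin // lee_fin fsbig_finite //.
have [n An] := exhaust_seq (finmap.enum_fset (fset_set A)).
by apply: le_trans (hM n); apply: ler_sum_subset => //; exact: finmap.fset_uniq.
Qed.

Lemma sum_le_esum h (s : seq X) : uniq s ->
  ((\sum_(x <- s) h x)%:E <= esum setT (fun x => (h x)%:E))%E.
Proof.
move=> us; apply: esum_ge; exists [set` s]%classic; first by split.
by rewrite -sumEFin fsbig_seq.
Qed.

Lemma esum_cvg h l : (forall x, 0 <= h x) ->
  (\sum_(x <- B n) h x @[n --> \oo] --> l)%classic ->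
  esum setT (fun x => (h x)%:E) = l%:E.
Proof.
move=> h0 hl.
have nd : nondecreasing_seq (fun n => \sum_(x <- B n) h x).
  by move=> m n mn; apply: ler_sum_subset => //; exact: B_mono.
have cv : cvgn (fun n => \sum_(x <- B n) h x) by apply/cvg_ex; exists l.
apply/eqP; rewrite eq_le; apply/andP; split.
  apply: esum_le_exhaust => // n; rewrite -(cvg_lim _ hl) //.
  exact: nondecreasing_cvgn_le.
have : esum setT (fun x => (h x)%:E) \is a fin_num.
  rewrite ge0_fin_numE ?esum_ge0 //; last by move=> x _; rewrite lee_fin.
  apply: le_lt_trans (ltry (limn (fun n => \sum_(x <- B n) h x))).
  by apply: esum_le_exhaust => // n; exact: nondecreasing_cvgn_le.
case E: (esum _ _) => [r||] // _; rewrite lee_fin -(cvg_lim _ hl) //.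
apply: limr_le => //; apply: nearW => n.
by rewrite -lee_fin -E sum_le_esum.
Qed.

Lemma rsum_cvg u M : (forall n, \sum_(x <- B n) `|u x| <= M) ->
  (\sum_(x <- B n) u x @[n --> \oo] --> rsum u)%classic.
Proof.
move=> uM.
have part (v : X -> R) : (forall x, 0 <= v x <= `|u x|) ->
    exists2 l, (\sum_(x <- B n) v x @[n --> \oo] --> l)%classic &
      esum setT (fun x => (v x)%:E) = l%:E.
  move=> vu; have v0 x : 0 <= v x by have /andP[] := vu x.
  have : cvgn (fun n => \sum_(x <- B n) v x).
    apply: nondecreasing_is_cvgn => [m n mn|].
      by apply: ler_sum_subset => //; exact: B_mono.
    exists M => _ [n _ <-]; apply: le_trans (uM n); apply: ler_sum => x _.
    by have /andP[] := vu x.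
  by case/cvg_ex => l hl; exists l => //; exact: esum_cvg.
have [|lp cp ep] := part (fun x => Num.max (u x) 0).
  by move=> x; rewrite le_max lexx orbT /= ge_max ler_norm normr_ge0.
have [|ln cn en] := part (fun x => Num.max (- u x) 0).
  by move=> x; rewrite le_max lexx orbT /= ge_max -normrN ler_norm normr_ge0.
have -> : rsum u = lp - ln.
  rewrite /rsum.
  rewrite (_ : (EFin \o u)^\+%E = (fun x => (Num.max (u x) 0)%:E)); last first.
    by apply/funext => x; rewrite funeposE /= EFin_max.
  rewrite (_ : (EFin \o u)^\-%E = (fun x => (Num.max (- u x) 0)%:E)); last first.
    by apply/funext => x; rewrite funenegE /= EFin_max.
  by rewrite ep en.
rewrite (_ : (fun n => _) = (fun n => \sum_(x <- B n) Num.max (u x) 0) \-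
    (fun n => \sum_(x <- B n) Num.max (- u x) 0)); last first.
  apply/funext => n /=; rewrite -sumrB; apply: eq_bigr => x _.
  by case: (leP (u x) 0) => h; case: (leP (- u x) 0) => h'; lra.
exact: cvgB.
Qed.

Lemma rsum_le u M : (forall n, \sum_(x <- B n) `|u x| <= M) -> `|rsum u| <= M.
Proof.
move=> uM; have hc := rsum_cvg uM.
rewrite -(cvg_lim _ (cvg_norm hc)) //; apply: limr_le.
  by apply/cvg_ex; eexists; exact: cvg_norm hc.
apply: nearW => n; apply: le_trans (uM n); exact: ler_norm_sum.
Qed.

End Exhaustion.

(** * Schur's test and power sums over balls *)

Section Schur.
Variable R : realType.

(** Jensen's inequality for the convex function [y `^ p] with unnormalised
    weights [A].  It follows from Young's inequality
    [y * m `^ (p - 1) <= y `^ p / p + m `^ p * (1 - 1 / p)] at the weighted mean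
    [m]. *)
Lemma powR_sum_le (I : eqType) (s : seq I) (A y : I -> R) (p : R) : 1 < p ->
  (forall i, 0 <= A i) -> (forall i, 0 <= y i) ->
  (\sum_(i <- s) A i * y i) `^ p <=
  (\sum_(i <- s) A i) `^ (p - 1) * \sum_(i <- s) A i * y i `^ p.
Proof.
move=> p1 A0 y0; have p0 : 0 < p by lra.
set M := \sum_(i <- s) A i * y i; set S := \sum_(i <- s) A i.
have M0 : 0 <= M by apply: sumr_ge0 => i _; rewrite mulr_ge0.
have S0 : 0 <= S by apply: sumr_ge0 => i _.
case: (eqVneq M 0) => [->|Mn0].
  rewrite powR0 ?gt_eqF // mulr_ge0 ?powR_ge0 //.
  by apply: sumr_ge0 => i _; rewrite mulr_ge0 // powR_ge0.
have Sn0 : S != 0.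
  apply: contra Mn0 => S0'; apply/eqP; rewrite /M big_seq big1 // => i si.
  move: S0'; rewrite /S psumr_eq0 // => /allP/(_ i si)/eqP ->; exact: mul0r.
have Sgt : 0 < S by rewrite lt_neqAle eq_sym Sn0.
have Mgt : 0 < M by rewrite lt_neqAle eq_sym Mn0.
pose m := M / S; have mgt : 0 < m by rewrite divr_gt0.
(* Young's inequality at [m], multiplied by [A i] and summed. *)
have key : M * m `^ (p - 1) <= \sum_(i <- s) A i * y i `^ p.
  have young i : y i * m `^ (p - 1) <= y i `^ p / p + m `^ p / (p / (p - 1)).
    have := @conjugate_powR R (y i) (m `^ (p - 1)) p (p / (p - 1)) (y0 i)
      (powR_ge0 _ _) p0.
    rewrite -powRrM (_ : (p - 1) * (p / (p - 1)) = p); last by field; lra.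
    by apply; [rewrite divr_gt0 // subr_gt0|field; lra].
  have : M * m `^ (p - 1) <=
      (\sum_(i <- s) A i * y i `^ p) / p + S * (m `^ p / (p / (p - 1))).
    rewrite /M /S !mulr_suml -big_split /=; apply: ler_sum => i _.
    by rewrite -!mulrA -mulrDr ler_wpM2l.
  have -> : S * (m `^ p / (p / (p - 1))) = M * m `^ (p - 1) * ((p - 1) / p).
    rewrite -(@mulr_powRB1 _ m p) ?(ltW mgt) // /m; field.
    by rewrite Sn0 /=; apply/andP; split; lra.
  move=> h; have : M * m `^ (p - 1) / p <= (\sum_(i <- s) A i * y i `^ p) / p.
    move: h; rewrite -lerBlDr; congr (_ <= _); field; lra.
  by rewrite ler_pM2r // invr_gt0.
have -> : M `^ p = S `^ (p - 1) * (M * m `^ (p - 1)).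
  rewrite mulrCA -powRM ?(ltW mgt) // /m mulrCA divff // mulr1.
  by rewrite mulr_powRB1.
by rewrite ler_wpM2l // powR_ge0.
Qed.

(** Schur's test.  Writing [H f = (H u) (f / u)], Jensen's inequality for the
    weights [H z x * u x] bounds the [p]-th power of the inner sum by the first
    hypothesis; the second one then bounds the sum over [z]. *)
Lemma schur_test (I : eqType) (s t : seq I) (H : I -> I -> R) (f u mu : I -> R)
    (p A A' : R) : 1 < p -> (forall z x, 0 <= H z x) -> (forall x, 0 <= f x) ->
  (forall x, 0 < u x) -> (forall x, 0 <= mu x) -> 0 <= A ->
  (forall z, \sum_(x <- s) H z x * u x <= A * u z) ->
  (forall x, \sum_(z <- t) H z x * u z `^ (p - 1) * mu z <=
     A' * (u x `^ (p - 1) * mu x)) ->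
  \sum_(z <- t) (\sum_(x <- s) H z x * f x) `^ p * mu z <=
  A `^ (p - 1) * A' * \sum_(x <- s) f x `^ p * mu x.
Proof.
move=> p1 H0 f0 u0 mu0 A0 h1 h2; have p0 : 0 < p by lra.
have ur x : 0 < u x `^ (p - 1) by rewrite powR_gt0.
have step z : (\sum_(x <- s) H z x * f x) `^ p <=
    A `^ (p - 1) * u z `^ (p - 1) *
    \sum_(x <- s) H z x * (f x `^ p / u x `^ (p - 1)).
  have e1 : \sum_(x <- s) H z x * f x = \sum_(x <- s) H z x * u x * (f x / u x).
    by apply: eq_bigr => x _; field; rewrite gt_eqF.
  have -> : \sum_(x <- s) H z x * (f x `^ p / u x `^ (p - 1)) =
      \sum_(x <- s) H z x * u x * (f x / u x) `^ p.
    apply: eq_bigr => x _; rewrite -mulrA; congr (_ * _).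
    rewrite powRM ?invr_ge0 ?(ltW (u0 x)) //.
    rewrite -[(u x)^-1]powR_inv1 ?(ltW (u0 x)) // -powRrM mulN1r powRN.
    rewrite -(@mulr_powRB1 _ (u x) p) ?(ltW (u0 x)) //; field.
    by rewrite !gt_eqF.
  have := @powR_sum_le _ s (fun x => H z x * u x) (fun x => f x / u x) p p1.
  rewrite -e1.
  move=> h; apply: le_trans (h _ _) _ => [x|x|].
  - by rewrite mulr_ge0 // ltW.
  - by rewrite divr_ge0 // ltW.
  apply: ler_wpM2r.
    by apply: sumr_ge0 => x _; rewrite mulr_ge0 ?powR_ge0 // mulr_ge0 // ltW.
  rewrite -powRM ?(ltW (u0 z)) //; apply: ge0_ler_powR; rewrite ?nnegrE //.
  - by rewrite subr_ge0 ltW.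
  - by apply: sumr_ge0 => x _; rewrite mulr_ge0 // ltW.
  - by rewrite mulr_ge0 // ltW.
have : \sum_(z <- t) (\sum_(x <- s) H z x * f x) `^ p * mu z <=
    A `^ (p - 1) * \sum_(x <- s) f x `^ p / u x `^ (p - 1) *
      \sum_(z <- t) H z x * u z `^ (p - 1) * mu z.
  apply: le_trans (_ : _ <= \sum_(z <- t) (A `^ (p - 1) * u z `^ (p - 1) *
    \sum_(x <- s) H z x * (f x `^ p / u x `^ (p - 1))) * mu z) _.
    by apply: ler_sum => z _; rewrite ler_wpM2r.
  rewrite mulr_sumr; under [leRHS]eq_bigr do rewrite mulr_sumr mulr_sumr.
  rewrite exchange_big /=; apply: ler_sum => z _.
  rewrite mulr_sumr mulr_suml; apply: ler_sum => x _.
  by rewrite le_eqVlt; apply/orP; left; apply/eqP; ring.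
move/le_trans; apply; rewrite -mulrA ler_wpM2l ?powR_ge0 // mulr_sumr.
apply: ler_sum => x _.
apply: le_trans (ler_wpM2l _ (h2 x)) _; first by rewrite divr_ge0 ?powR_ge0.
by rewrite le_eqVlt; apply/orP; left; apply/eqP; field; rewrite gt_eqF.
Qed.

Lemma geometric_le (r : R) n : 0 <= r < 1 -> \sum_(i < n) r ^+ i <= (1 - r)^-1.
Proof.
move=> /andP[r0 r1]; rewrite -[leRHS]mul1r ler_pdivlMr ?subr_gt0 // mulrC.
rewrite -[1 - r]opprB mulNr -subrX1 opprB; have := exprn_ge0 n r0; lra.
Qed.

Lemma geometric_le_last (r : R) n : 1 < r ->
  \sum_(i < n.+1) r ^+ i <= r / (r - 1) * r ^+ n.
Proof.
move=> r1; rewrite mulrAC -exprS ler_pdivlMr ?subr_gt0 // mulrC -subrX1; lra.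
Qed.

End Schur.

Section TreeSums.
Variables (q : nat) (X : choiceType) (o : X) (lvl : X -> nat) (par : X -> X).
Variable ch : X -> seq X.
Hypothesis T : rooted_tree q o lvl par ch.
Hypothesis q0 : (0 < q)%N.
Variable R : realType.
Local Notation anc := (anc lvl par).
Local Notation above := (above lvl par).
Local Notation generation := (generation ch).
Local Notation ball := (subtree ch o).

Lemma sum_generation_pow (t : R) u d :
  \sum_(x <- generation u d) t ^+ lvl x = (size (generation u d))%:R * t ^+ (lvl u + d).
Proof.
by apply: sum_seq_const => x; rewrite (mem_generation T) => /andP[/eqP -> _].
Qed.

Lemma sum_above_pow (t : R) u N : 0 <= t -> q%:R * t < 1 ->
  \sum_(x <- ball N | above u x) t ^+ lvl x <= 2 / (1 - q%:R * t) * t ^+ lvl u.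
Proof.
move=> t0 qt1; rewrite (sum_ball_above T) sum_subtree.
apply: le_trans (_ : _ <= \sum_(d < N - lvl u) 2 * t ^+ lvl u * (q%:R * t) ^+ d) _.
  apply: ler_sum => d _; rewrite sum_generation_pow.
  have := size_generation_le T u d q0; rewrite -(ler_nat R) => h.
  apply: le_trans (ler_wpM2r _ h) _; first by rewrite exprn_ge0.
  by rewrite natrM natrX exprD exprMn le_eqVlt; apply/orP; left; apply/eqP; ring.
rewrite -mulr_sumr -[2 / _ * _]mulrAC ler_wpM2l ?mulr_ge0 ?exprn_ge0 //.
by apply: geometric_le; rewrite qt1 mulr_ge0.
Qed.

(** Up to constants this is [r ^ m], with [m] the level of the last common
    ancestor of [z] and [x], when [r > 1].  The sum is easier to handle than the
    single term: it is symmetric, and exchanging it with a sum over [x]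
    leaves sums over the descendants of the ancestors of [z]. *)
Definition confluence (r : R) z x :=
  \sum_(i < (minn (lvl z) (lvl x)).+1 | anc i z == anc i x) r ^+ i.

Lemma confluenceC r z x : confluence r z x = confluence r x z.
Proof. by rewrite /confluence minnC; apply: eq_bigl => i; rewrite eq_sym. Qed.

Lemma confluenceE r z x : confluence r z x =
  \sum_(i < (lvl z).+1 | above (anc i z) x) r ^+ i.
Proof.
rewrite /confluence (big_ord_widen_cond (lvl z).+1 (fun i => anc i z == anc i x)
  (fun i => r ^+ i)) ?ltnS ?geq_minl //.
apply: eq_bigl => i; have iz : (i <= lvl z)%N by rewrite -ltnS.
by rewrite (above_ancE T) // ltnS leq_min iz eq_sym andbC.
Qed.

Lemma le_confluence r r' z x : 0 <= r -> r <= r' ->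
  confluence r z x <= confluence r' z x.
Proof.
move=> r0 rr; apply: ler_sum => i _.
by rewrite lerXn2r ?nnegrE ?(le_trans r0).
Qed.

(** The sum over [x] is a geometric sum over the generations below each ancestor
    of [z], and its ratio [q * t] is below [1]; the remaining sum over the
    ancestors of [z] is geometric of ratio [r * t > 1] and thus dominated by its
    last term. *)
Lemma sum_confluence_pow (r t : R) z N : 0 <= r -> 0 <= t -> q%:R * t < 1 ->
  1 < r * t -> \sum_(x <- ball N) confluence r z x * t ^+ lvl x <=
    2 / (1 - q%:R * t) * (r * t / (r * t - 1)) * (r * t) ^+ lvl z.
Proof.
move=> r0 t0 qt1 rt1.
under eq_bigr do rewrite confluenceE mulr_suml.
rewrite (exchange_big_dep xpredT) //=.
apply: le_trans (_ : _ <= \sum_(i < (lvl z).+1) 2 / (1 - q%:R * t) * (r * t) ^+ i) _.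
  apply: ler_sum => i _; have iz : (i <= lvl z)%N by rewrite -ltnS.
  rewrite -mulr_sumr; apply: le_trans (ler_wpM2l _ (sum_above_pow _ _ t0 qt1)) _.
    by rewrite exprn_ge0.
  by rewrite (lvl_anc T) // exprMn le_eqVlt; apply/orP; left; apply/eqP; ring.
rewrite -mulr_sumr -!mulrA ler_wpM2l // ler_wpM2l ?invr_ge0 ?subr_ge0 ?(ltW qt1) //.
by rewrite !mulrA geometric_le_last.
Qed.

End TreeSums.

(** * Discrete Green functions and their harmonic combinations *)

Lemma sum_indicator (R : pzSemiRingType) (X : eqType) (s : seq X) u : uniq s ->
  \sum_(y <- s) (y == u)%:R = (u \in s)%:R :> R.
Proof.
move=> us; rewrite -count_uniq_mem // -sum1_count natr_sum [RHS]big_mkcond.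
by apply: eq_bigr => y _ /=; case: eqP.
Qed.

Section Kernel.
Variables (q : nat) (X : choiceType) (o : X) (lvl : X -> nat) (par : X -> X).
Variable ch : X -> seq X.
Hypothesis T : rooted_tree q o lvl par ch.
Hypothesis q2 : (2 <= q)%N.
Variable R : realType.
Implicit Types (f g : X -> R) (t : R).
Local Notation anc := (anc lvl par).
Local Notation above := (above lvl par).
Local Notation generation := (generation ch).
Local Notation ball := (subtree ch o).

Let q0 : (0 < q)%N. Proof. exact: leq_trans q2. Qed.
Let Q0 : (0 : R) < q%:R. Proof. by rewrite ltr0n. Qed.
Let Qn0 : (q%:R : R) != 0. Proof. by rewrite gt_eqF. Qed.

(** [q + 1] times the usual Laplacian (average over the neighbours minus value),
    written in terms of parents and children. *)
Definition laplacian f w : R :=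
  \sum_(u <- ch w) f u + (if w == o then 0 else f (par w)) - q.+1%:R * f w.

Definition real_harmonic f := forall w, laplacian f w = 0.

(** The value at distance [d] from the pole of a radial function that vanishes at
    the pole, equals [1] at distance one and is harmonic further away. *)
Definition slope d : R := \sum_(j < d) q%:R^-1 ^+ j.

Lemma slope0 : slope 0 = 0.
Proof. by rewrite /slope big_ord0. Qed.

Lemma slopeS d : slope d.+1 = 1 + slope d / q%:R.
Proof.
rewrite /slope big_ord_recl expr0 mulr_suml; congr (_ + _).
by apply: eq_bigr => i _; rewrite exprSr.
Qed.

Lemma slope_ge0 d : 0 <= slope d.
Proof. by apply: sumr_ge0 => i _; rewrite exprn_ge0 // invr_ge0 ltW. Qed.

Lemma slope_ge1 d : 1 <= slope d.+1.
Proof. by rewrite slopeS lerDl divr_ge0 ?slope_ge0 // ltW. Qed.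

Lemma slope_le2 d : slope d <= 2.
Proof.
have Q2 : (2 : R) <= q%:R by rewrite ler_nat.
elim: d => [|d IH]; first by rewrite slope0.
rewrite slopeS -lerBrDl ler_pdivrMr //; lra.
Qed.

Lemma slope_harmonic d :
  q%:R * slope d.+2 + slope d - q.+1%:R * slope d.+1 = 0.
Proof. by rewrite (slopeS d.+1) (slopeS d) -[q.+1%:R]natr1; field. Qed.

(** The radial harmonic function with pole [par u], cut off to the descendants of
    [u]; the cut creates the only defect of harmonicity, at [par u]. *)
Definition green u x : R := if above u x then slope (lvl x - lvl u).+1 else 0.

Lemma green_ge0 u x : 0 <= green u x.
Proof. by rewrite /green; case: ifP => // _; exact: slope_ge0. Qed.

Lemma laplacian_green u w : u != o -> laplacian (green u) w = (par u == w)%:R.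
Proof.
move=> uo; rewrite /laplacian; case: (boolP (above u w)) => uw.
  have luw : (lvl u <= lvl w)%N by case/andP: uw.
  have wo : w != o.
    apply: contra uo => /eqP wo; apply/eqP/(lvl_eq_root T).
    by move: luw; rewrite wo (lvl_root T); case: (lvl u).
  have -> : (par u == w) = false.
    by apply: contraTF luw => /eqP <-; rewrite -ltnNge (lvl_par T uo).
  rewrite (negPf wo) -[RHS](slope_harmonic (lvl w - lvl u)).
  congr (_ + _ - _ * _); last by rewrite /green uw.
  - rewrite (@sum_seq_const _ _ _ _ (slope (lvl w - lvl u).+2)) => [|y yw].
      by rewrite (size_ch T) (negPf wo) addn0.
    have yu : y != u.
      by apply: contraTneq luw => <-; rewrite (lvl_ch T yw) ltnn.
    rewrite /green (above_par T uo (ch_neq_root T yw) yu) (ch_par T yw) uw.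
    by rewrite (lvl_ch T yw) subSn.
  - rewrite /green; case: (eqVneq w u) => [->|wu].
      rewrite subnn slope0; case: ifP => // /andP[].
      by rewrite leqNgt (lvl_par T uo) ltnSn.
    rewrite -(above_par T uo wo wu) uw; congr slope.
    have : above u (par w) by rewrite -(above_par T uo wo wu).
    by case/andP => h _; rewrite (lvl_par T wo) subSn.
have gch y : y \in ch w -> green u y = (y == u)%:R.
  move=> yw; rewrite /green; case: (eqVneq y u) => [->|yu].
    by rewrite above_refl subnn slopeS slope0 mul0r addr0.
  by rewrite (above_par T uo (ch_neq_root T yw) yu) (ch_par T yw) (negPf uw).
have -> : green u w = 0 by rewrite /green (negPf uw).
have -> : (if w == o then 0 else green u (par w)) = 0.
  case: ifPn => // wo; rewrite /green; case: ifP => // upw; case/negP: uw.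
  case: (eqVneq w u) => [->|wu]; first exact: above_refl.
  by rewrite (above_par T uo wo wu).
rewrite mulr0 subr0 addr0 big_seq (eq_bigr _ gch) -big_seq.
by rewrite (sum_indicator _ _ (ch_uniq T w)) (mem_ch T) uo.
Qed.

Lemma green_root u : u != o -> green u o = 0.
Proof.
move=> uo; rewrite /green; case: ifP => // /andP[].
by rewrite (lvl_par T uo) (lvl_root T).
Qed.

Lemma green_le u v x : u \in ch v -> green u x <= 2 * (above v x)%:R.
Proof.
move=> uv; rewrite /green; case: ifP => [/(above_ch T uv) ->|_].
  by rewrite mulr1 slope_le2.
by rewrite mulr_ge0.
Qed.

(** Averaging over the siblings cancels the defect of [green u] at their common
    parent. *)
Definition mode u x : R :=
  green u x - (\sum_(w <- ch (par u)) green w x) / (size (ch (par u)))%:R.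

Lemma size_ch_gt0 v : (0 : R) < (size (ch v))%:R.
Proof. by rewrite ltr0n (size_ch T) addn_gt0 q0. Qed.

Lemma size_ch_neq0 v : (size (ch v))%:R != 0 :> R.
Proof. by rewrite gt_eqF // size_ch_gt0. Qed.

Lemma laplacian_mode u : u != o -> real_harmonic (mode u).
Proof.
move=> uo w; have luo := laplacian_green w uo.
have : laplacian (mode u) w = laplacian (green u) w -
    (\sum_(y <- ch (par u)) laplacian (green y) w) / (size (ch (par u)))%:R.
  rewrite /laplacian /mode big_split /= sumrN -mulr_suml exchange_big /=.
  rewrite !big_split /= sumrN -mulr_sumr.
  by case: ifP => _; rewrite ?big1_eq; ring.
move=> ->; rewrite luo (@sum_seq_const _ _ _ _ (par u == w)%:R) => [|y yu].
  by rewrite mulrC mulKf ?subrr // size_ch_neq0.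
by rewrite laplacian_green ?(ch_neq_root T yu) // (ch_par T yu).
Qed.

(** The children of [v] have disjoint sets of descendants, so at most one term is
    nonzero. *)
Lemma sum_green_ch u v x : u \in ch v -> above u x ->
  \sum_(w <- ch v) green w x = green u x.
Proof.
move=> uv ux; rewrite (bigD1_seq u) ?(ch_uniq T) //= big_seq_cond big1 ?addr0 //.
move=> w /andP[wv wu]; rewrite /green; case: ifP => // wx.
case/eqP: wu; case/andP: wx => _ /eqP <-; case/andP: ux => _ /eqP <-.
by rewrite (lvl_ch T uv) (lvl_ch T wv).
Qed.

Lemma mode_le u x : u != o -> `|mode u x| <= 2 * (above (par u) x)%:R.
Proof.
move=> uo; have uv : u \in ch (par u) by rewrite (mem_ch T) uo eqxx.
have g1 := green_le x uv; have g0 := green_ge0 u x.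
have h0 : 0 <= (\sum_(w <- ch (par u)) green w x) / (size (ch (par u)))%:R.
  by rewrite divr_ge0 // ?sumr_ge0 // => w _; exact: green_ge0.
have h1 : (\sum_(w <- ch (par u)) green w x) / (size (ch (par u)))%:R <=
    2 * (above (par u) x)%:R.
  rewrite ler_pdivrMr ?size_ch_gt0 // mulrC.
  rewrite -(@sum_seq_const _ _ _ (fun=> 2 * (above (par u) x)%:R)) //.
  rewrite big_seq [leRHS]big_seq.
  by apply: ler_sum => w wv; exact: green_le.
by rewrite /mode ler_norml; apply/andP; split; lra.
Qed.

Lemma mode_above u x : u != o -> above u x ->
  mode u x = green u x * (1 - (size (ch (par u)))%:R^-1).
Proof.
move=> uo ux; rewrite /mode (sum_green_ch _ ux) ?(mem_ch T) ?uo ?eqxx //.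
by rewrite mulrBr mulr1.
Qed.

Lemma mode_root u : u != o -> mode u o = 0.
Proof.
move=> uo; rewrite /mode green_root // big_seq big1 ?mul0r ?subr0 // => w wu.
by rewrite green_root // (ch_neq_root T wu).
Qed.

(** Summing the harmonicity condition over a generation gives a second order
    linear recurrence for the generation sums, with the same solutions as the
    recurrence that [slope] satisfies, up to a factor [q ^+ d]. *)
Lemma sum_generation_harmonic g u d : real_harmonic g -> u != o ->
  \sum_(x <- generation u d) g x =
  q%:R ^+ d * (g (par u) + (g u - g (par u)) * slope d.+1).
Proof.
move=> hg uo; have gch w : w != o ->
    \sum_(y <- ch w) g y = q.+1%:R * g w - g (par w).
  move=> wo; have := hg w; rewrite /laplacian (negPf wo); lra.
have neq_o k x : x \in generation u k -> x != o.
  rewrite (mem_generation T) (lvl_par T uo) => /andP[/eqP lx _].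
  by apply/eqP => xo; move: lx; rewrite xo (lvl_root T).
have rec k : \sum_(x <- generation u k.+2) g x =
    q.+1%:R * \sum_(x <- generation u k.+1) g x - q%:R * \sum_(x <- generation u k) g x.
  rewrite sum_generationS big_seq (eq_bigr (fun w => q.+1%:R * g w - g (par w))).
    rewrite -big_seq sumrB -mulr_sumr; congr (_ - _).
    rewrite sum_generationS mulr_sumr big_seq [RHS]big_seq; apply: eq_bigr => y yu.
    rewrite (@sum_seq_const _ _ _ _ (g y)) => [|x xy]; last by rewrite (ch_par T xy).
    by rewrite (size_ch T) (negPf (neq_o _ _ yu)) addn0.
  by move=> w /neq_o wo; rewrite gch.
(* The recurrence has order two, so two consecutive generations are carried
   along. *)
suff [//] : \sum_(x <- generation u d) g x =
  q%:R ^+ d * (g (par u) + (g u - g (par u)) * slope d.+1) /\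
  \sum_(x <- generation u d.+1) g x =
  q%:R ^+ d.+1 * (g (par u) + (g u - g (par u)) * slope d.+2).
elim: d => [|d [IH1 IH2]].
  rewrite sum_generationS !big_seq1 gch // !slopeS slope0 expr0 expr1 -natr1.
  by split; [ring|field].
split=> //; rewrite rec IH1 IH2 (slopeS d.+2) (slopeS d.+1) (slopeS d) !exprS -natr1.
by field.
Qed.

(** The mean value property of harmonic functions on spheres. *)
Lemma sum_generation_root_harmonic g d : real_harmonic g ->
  \sum_(x <- generation o d) g x = (size (generation o d))%:R * g o.
Proof.
move=> hg; case: d => [|d]; first by rewrite big_seq1 mul1r.
have : \sum_(v <- ch o) g v = q.+1%:R * g o.
  by have := hg o; rewrite /laplacian eqxx addr0 => /subr0_eq.
rewrite sum_generation_ch => go.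
rewrite (eq_big_seq (fun v => q%:R ^+ d * (g o + (g v - g o) * slope d.+1))).
  rewrite -mulr_sumr big_split /= -mulr_suml sumrB go.
  rewrite !(@sum_seq_const _ _ _ _ (g o)) // (size_ch T) eqxx addn1.
  by rewrite (size_generation_root T) natrM natrX; ring.
by move=> v vo; rewrite sum_generation_harmonic ?(ch_neq_root T vo) // (ch_par T vo).
Qed.
End Kernel.

(** * A reproducing kernel on the rooted tree *)

Section Reproducing.
Variables (q : nat) (X : choiceType) (o : X) (lvl : X -> nat) (par : X -> X).
Variable ch : X -> seq X.
Hypothesis T : rooted_tree q o lvl par ch.
Hypothesis q2 : (2 <= q)%N.
Variables (R : realType) (t : R).
Hypothesis t0 : 0 < t.
Hypothesis qt1 : q%:R * t < 1.
Implicit Types (f g : X -> R).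
Local Notation anc := (anc lvl par).
Local Notation above := (above lvl par).
Local Notation generation := (generation ch).
Local Notation ball := (subtree ch o).
Local Notation slope := (slope q R).
Local Notation mode := (mode q lvl par ch R).
Local Notation green := (green q lvl par R).
Local Notation laplacian := (laplacian q o par ch).
Local Notation real_harmonic := (real_harmonic q o par ch).

Let q0 : (0 < q)%N. Proof. exact: leq_trans q2. Qed.
Let Q0 : (0 : R) < q%:R. Proof. by rewrite ltr0n. Qed.
Let Qn0 : (q%:R : R) != 0. Proof. by rewrite gt_eqF. Qed.
Let tn0 : t != 0. Proof. by rewrite gt_eqF. Qed.
Let qt0 : 0 <= q%:R * t. Proof. by rewrite mulr_ge0 // ltW. Qed.

(** Up to the factor [t ^+ lvl u], the square norm of [green u] over the first [M]
    generations. *)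
Definition slope2_sum M : R := \sum_(d < M) slope d.+1 ^+ 2 * (q%:R * t) ^+ d.

(** The partial sums of the total mass of the weight [t ^+ lvl x]. *)
Definition mass_sum M : R := \sum_(d < M) (size (generation o d))%:R * t ^+ d.

Lemma sum_ball_green g u N : real_harmonic g -> u != o ->
  \sum_(x <- ball N) g x * green u x * t ^+ lvl x =
  t ^+ lvl u * (g (par u) * (\sum_(d < N - lvl u) slope d.+1 * (q%:R * t) ^+ d) +
                (g u - g (par u)) * slope2_sum (N - lvl u)).
Proof.
move=> hg uo.
rewrite (eq_bigr (fun x => if above u x then
    g x * slope (lvl x - lvl u).+1 * t ^+ lvl x else 0)); last first.
  by move=> x _; rewrite /green; case: ifP => // _; rewrite mulr0 mul0r.
rewrite -big_mkcond (sum_ball_above T) sum_subtree mulrDr /slope2_sum !mulr_sumr.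
rewrite -big_split /=; apply: eq_bigr => d _.
rewrite (eq_big_seq (fun x => g x * (slope d.+1 * t ^+ (lvl u + d)))) => [|x].
  by rewrite -mulr_suml (sum_generation_harmonic T q2) // exprD exprMn; ring.
by rewrite (mem_generation T) => /andP[/eqP -> _]; rewrite addKn mulrA.
Qed.

(** In the pairing of [g] with [green u], the term in [g (par u)] is the same for
    all siblings of [u], hence disappears for [mode u].  By harmonicity of [g] at
    [par u], the average over the siblings of the remaining term is the previous
    increment of [g] divided by [q], or zero if [par u] is the root. *)
Lemma sum_ball_mode g u N : real_harmonic g -> u != o ->
  \sum_(x <- ball N) g x * mode u x * t ^+ lvl x =
  t ^+ lvl u * slope2_sum (N - lvl u) *
    ((g u - g (par u)) -
     (if par u == o then 0 else g (par u) - g (par (par u))) / q%:R).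
Proof.
move=> hg uo; set v := par u; set k : R := (size (ch v))%:R.
have kn0 : k != 0 by apply: (size_ch_neq0 T q2).
set S1 := \sum_(d < N - lvl u) slope d.+1 * (q%:R * t) ^+ d.
set S2 := slope2_sum (N - lvl u).
have -> : \sum_(x <- ball N) g x * mode u x * t ^+ lvl x =
    \sum_(x <- ball N) g x * green u x * t ^+ lvl x -
    (\sum_(w <- ch v) \sum_(x <- ball N) g x * green w x * t ^+ lvl x) / k.
  rewrite exchange_big /= mulr_suml -sumrB; apply: eq_bigr => x _.
  rewrite /mode -/v -/k -!mulr_suml -mulr_sumr; ring.
rewrite sum_ball_green // -/v -/S1 -/S2.
rewrite (eq_big_seq (fun w => t ^+ lvl u * (g v * S1 + (g w - g v) * S2))); last first.
  move=> w wv; rewrite sum_ball_green ?(ch_neq_root T wv) //.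
  have -> : lvl w = lvl u by rewrite (lvl_ch T wv) (lvl_par T uo).
  by rewrite (ch_par T wv).
rewrite -mulr_sumr big_split /= (@sum_seq_const _ _ _ _ (g v * S1)) // -/k.
rewrite -mulr_suml sumrB.
rewrite (@sum_seq_const _ _ _ (fun=> g v) (g v)) // -/k.
have -> : (if v == o then 0 else g v - g (par v)) / q%:R =
    (\sum_(w <- ch v) g w - k * g v) / k.
  have := hg v; rewrite /laplacian /k (size_ch T) -natr1.
  case: eqP => vo h.
    by rewrite natrD mul0r [X in X / _](_ : _ = 0) ?mul0r //; move: h; rewrite addr0.
  rewrite addn0; congr (_ / _); move: h; lra.
by field.
Qed.

(** Summation by parts with [slope d.+1 - slope d / q = 1]. *)
Lemma sum_slope_telescope (d : nat -> R) n : d 0%N = 0 ->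
  \sum_(i < n) slope (n - i) * (d i.+1 - d i / q%:R) = \sum_(i < n) d i.+1.
Proof.
move=> d0; case: n => [|n]; first by rewrite !big_ord0.
under eq_bigr do rewrite mulrBr.
rewrite sumrB [X in _ - X]big_ord_recl d0 mul0r mulr0 add0r.
rewrite big_ord_recr [RHS]big_ord_recr /= subSnn addrAC; congr (_ + _).
  rewrite -sumrB; apply: eq_bigr => i _; rewrite /bump add1n subSS.
  by rewrite subSn ?(ltnW (ltn_ord i)) // slopeS //; field.
by rewrite slopeS // slope0 mul0r addr0 mul1r.
Qed.

Lemma is_cvg_power_sum (w : nat -> R) (C : R) :
  (forall d, 0 <= w d <= C * (q%:R * t) ^+ d) ->
  cvgn (fun M => \sum_(d < M) w d).
Proof.
move=> wC.
have -> : (fun M => \sum_(d < M) w d) = series w.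
  by apply/funext => M; rewrite /series /= big_mkord.
apply: (@series_le_cvg _ w (geometric C (q%:R * t))).
- by move=> d; have /andP[] := wC d.
- by move=> d; have /andP[] := wC d => a b; apply: le_trans a b.
- by move=> d; have /andP[] := wC d.
- by apply: is_cvg_geometric_series; rewrite ger0_norm.
Qed.

Lemma is_cvg_slope2_sum : cvgn slope2_sum.
Proof.
apply: (@is_cvg_power_sum (fun d => slope d.+1 ^+ 2 * (q%:R * t) ^+ d) 4) => d;
 rewrite mulr_ge0 ?exprn_ge0 ?slope_ge0 //=.
rewrite ler_wpM2r ?exprn_ge0 // -[4](_ : 2 ^+ 2 = _); last by rewrite -natrX.
by rewrite lerXn2r ?nnegrE ?slope_ge0 ?slope_le2.
Qed.

Lemma is_cvg_mass_sum : cvgn mass_sum.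
Proof.
apply: (@is_cvg_power_sum (fun d => (size (generation o d))%:R * t ^+ d) 2) => d;
 rewrite mulr_ge0 ?exprn_ge0 ?(ltW t0) //=.
rewrite exprMn mulrA ler_wpM2r ?exprn_ge0 ?(ltW t0) //.
by rewrite -natrX -natrM ler_nat (size_generation_le T).
Qed.

Lemma sum_ball_pow N : \sum_(x <- ball N) t ^+ lvl x = mass_sum N.
Proof.
rewrite sum_subtree; apply: eq_bigr => d _.
by rewrite (sum_generation_pow T) (lvl_root T).
Qed.

Definition mass : R := limn mass_sum.
Definition slope2_series : R := limn slope2_sum.

Lemma limn_ge1 (w : nat -> R) : (forall d, 0 <= w d) -> w 0%N = 1 ->
  cvgn (fun M => \sum_(d < M) w d) -> 1 <= limn (fun M => \sum_(d < M) w d).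
Proof.
move=> w0 w1 cw; rewrite -[leLHS](_ : \sum_(d < 1) w d = 1); last first.
  by rewrite big_ord1.
apply: (@nondecreasing_cvgn_le _ (fun M => \sum_(d < M) w d)) => //.
apply/nondecreasing_seqP => n; rewrite big_ord_recr /=; by rewrite lerDl.
Qed.

Lemma mass_ge1 : 1 <= mass.
Proof.
apply: (@limn_ge1 (fun d => (size (generation o d))%:R * t ^+ d));
  last exact: is_cvg_mass_sum.
  by move=> d; rewrite mulr_ge0 ?exprn_ge0 // ltW.
by rewrite expr0 mulr1.
Qed.

Lemma slope2_series_ge1 : 1 <= slope2_series.
Proof.
apply: (@limn_ge1 (fun d => slope d.+1 ^+ 2 * (q%:R * t) ^+ d));
  last exact: is_cvg_slope2_sum.
  by move=> d; rewrite mulr_ge0 ?exprn_ge0 // ?slope_ge0.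
by rewrite slopeS // slope0 mul0r addr0 expr1n mul1r.
Qed.

(** The pairing of [g] with [mode (anc i.+1 z)] is [t ^+ i.+1 * slope2_series]
    times an increment of [g] minus a [q]-th of the previous one; the
    normalisation replaces that factor by the [slope (n - i)] of the telescoping
    sum. *)
Definition coefficient i n : R := slope (n - i) * t ^- i / (t * slope2_series).

(** Paired with a harmonic function, the constant reproduces its value at the root
    and the sum its increment from the root to [z]. *)
Definition tree_kernel z x : R :=
  mass^-1 + \sum_(i < lvl z) coefficient i (lvl z) * mode (anc i.+1 z) x.

Lemma sum_ball_kernel_cvg g z : real_harmonic g ->
  (\sum_(x <- ball N) g x * tree_kernel z x * t ^+ lvl x @[N --> \oo] --> g z)%classic.
Proof.
(* The increments of [g] along the geodesic; no edge arrives at the root. *)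
move=> hg; pose dl i := if i is j.+1 then g (anc i z) - g (anc j z) else 0.
have m0 : mass != 0 by rewrite gt_eqF // (lt_le_trans ltr01 mass_ge1).
have s0 : slope2_series != 0 by rewrite gt_eqF // (lt_le_trans ltr01 slope2_series_ge1).
have -> : (fun N => \sum_(x <- ball N) g x * tree_kernel z x * t ^+ lvl x) =
    (fun N => mass^-1 * g o * mass_sum N +
      \sum_(i < lvl z) coefficient i (lvl z) * (t ^+ i.+1 * (dl i.+1 - dl i / q%:R)) *
        slope2_sum (N - i.+1)).
  apply/funext => N.
  rewrite (eq_bigr (fun x => mass^-1 * (g x * t ^+ lvl x) + \sum_(i < lvl z)
     coefficient i (lvl z) * (g x * mode (anc i.+1 z) x * t ^+ lvl x))); last first.
    move=> x _; rewrite /tree_kernel mulrDr mulrDl mulr_sumr mulr_suml; congr (_ + _).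
      by ring.
    by apply: eq_bigr => i _; ring.
  rewrite big_split /= -mulr_sumr exchange_big /=; congr (_ + _).
    rewrite -mulrA; congr (_ * _); rewrite sum_subtree /mass_sum mulr_sumr.
    apply: eq_bigr => d _.
    rewrite (eq_big_seq (fun x => g x * t ^+ d)) => [|x]; last first.
      by rewrite (mem_generation T) (lvl_root T) add0n => /andP[/eqP -> _].
    by rewrite -mulr_suml (sum_generation_root_harmonic T q2) // mulrCA mulrA.
  apply: eq_bigr => i _; have iz := ltn_ord i.
  have dlE : dl i = if anc i z == o then 0 else g (anc i z) - g (par (anc i z)).
    case: (val i) iz => [|j] jz; first by rewrite (anc0 T) eqxx.
    by rewrite (negPf (anc_neq_root T (ltnW jz))) par_anc // ltnW.
  rewrite -mulr_sumr sum_ball_mode ?(anc_neq_root T) // (lvl_anc T) //.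
  by rewrite par_anc // -dlE /=; ring.
have -> : g z = mass^-1 * g o * mass +
      \sum_(i < lvl z) coefficient i (lvl z) * (t ^+ i.+1 * (dl i.+1 - dl i / q%:R)) *
        slope2_series.
  rewrite mulrAC mulVf // mul1r.
  rewrite (eq_bigr (fun i : 'I__ => slope (lvl z - i) * (dl i.+1 - dl i / q%:R))).
    rewrite sum_slope_telescope //.
    rewrite -(big_mkord xpredT (fun i => g (anc i.+1 z) - g (anc i z))).
    by rewrite telescope_sumr // (anc0 T) anc_lvl addrC subrK.
  move=> i _; rewrite /coefficient exprS; field.
  by rewrite s0 tn0 Qn0 expf_neq0.
apply: cvgD; first by apply: cvgMl_tmp; exact: is_cvg_mass_sum.
apply: (cvg_big (op := +%R) (x0 := 0)) => [|i _]; first exact: add_continuous.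
by apply: cvgMl_tmp; rewrite cvg_centern; exact: is_cvg_slope2_sum.
Qed.

Lemma laplacian_kernel z : real_harmonic (tree_kernel z).
Proof.
move=> w; have : laplacian (tree_kernel z) w = laplacian (fun=> mass^-1) w +
    \sum_(i < lvl z) coefficient i (lvl z) * laplacian (mode (anc i.+1 z)) w.
  have -> : \sum_(i < lvl z) coefficient i (lvl z) * laplacian (mode (anc i.+1 z)) w =
      \sum_(u <- ch w) \sum_(i < lvl z) coefficient i (lvl z) * mode (anc i.+1 z) u +
      (if w == o then 0 else
         \sum_(i < lvl z) coefficient i (lvl z) * mode (anc i.+1 z) (par w)) -
      q.+1%:R * \sum_(i < lvl z) coefficient i (lvl z) * mode (anc i.+1 z) w.
    rewrite exchange_big mulr_sumr /=; case: ifP => wo.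
      rewrite addr0 -sumrB; apply: eq_bigr => i _.
      by rewrite /laplacian wo -mulr_sumr; ring.
    rewrite -big_split -sumrB; apply: eq_bigr => i _ /=.
    by rewrite /laplacian wo -mulr_sumr; ring.
  by rewrite /laplacian /tree_kernel big_split /=; case: ifP => _; ring.
move=> ->; rewrite big1 => [|i _].
  rewrite addr0 /laplacian (@sum_seq_const _ _ _ _ mass^-1) // (size_ch T).
  by rewrite -natr1 natrD; case: eqP => _; rewrite ?mulr0n ?mulr1n; ring.
by rewrite (laplacian_mode T q2) ?mulr0 // (anc_neq_root T).
Qed.

Lemma coefficient_ge0 i n : 0 <= coefficient i n.
Proof.
rewrite /coefficient divr_ge0 ?mulr_ge0 ?slope_ge0 ?invr_ge0 ?exprn_ge0 ?(ltW t0) //.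
exact: le_trans slope2_series_ge1.
Qed.

Lemma tree_kernel_rootl x : tree_kernel o x = mass^-1.
Proof. by rewrite /tree_kernel (lvl_root T) big_ord0 addr0. Qed.

Lemma tree_kernel_rootr z : tree_kernel z o = mass^-1.
Proof.
rewrite /tree_kernel big1 ?addr0 // => i _.
by rewrite (mode_root T) ?mulr0 // (anc_neq_root T).
Qed.

Let s0 : 0 < slope2_series. Proof. exact: lt_le_trans slope2_series_ge1. Qed.
Let m0 : 0 < mass. Proof. exact: lt_le_trans mass_ge1. Qed.

(** [coefficient i _] is of order [t ^- i], and [mode] is bounded and supported on
    the descendants of the [i]-th ancestor of [z]: only the common ancestors of
    [z] and [x] count. *)
Lemma tree_kernel_le z x :
  `|tree_kernel z x| <=
  (mass^-1 + 4 / (t * slope2_series)) * confluence lvl par t^-1 z x.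
Proof.
rewrite (confluenceE T) mulrDl; apply: le_trans (ler_normD _ _) _; apply: lerD.
  rewrite ger0_norm ?invr_ge0 ?(ltW m0) // ler_peMr ?invr_ge0 ?(ltW m0) //.
  rewrite big_mkcond big_ord_recl (anc0 T) (above_root T) expr0 lerDl.
  by apply: sumr_ge0 => i _; case: ifP => // _; rewrite exprn_ge0 ?invr_ge0 ?(ltW t0).
apply: le_trans (ler_norm_sum _ _ _) _.
rewrite [X in _ <= _ * X]big_mkcond big_ord_recr /= mulrDr.
apply: le_trans (_ : _ <= 4 / (t * slope2_series) *
   \sum_(i < lvl z) (if above (anc i z) x then t^-1 ^+ i else 0)) _; last first.
  rewrite lerDl mulr_ge0 ?divr_ge0 ?mulr_ge0 ?(ltW t0) ?(ltW s0) //.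
  by case: ifP => // _; rewrite exprn_ge0 ?invr_ge0 ?(ltW t0).
rewrite mulr_sumr; apply: ler_sum => i _; have iz := ltn_ord i.
rewrite normrM ger0_norm ?coefficient_ge0 //.
have := mode_le T q2 R x (anc_neq_root T iz); rewrite par_anc // => h.
apply: le_trans (ler_wpM2l (coefficient_ge0 _ _) h) _.
case: ifP => _; last by rewrite !mulr0.
have ti : 0 <= t ^- i / (t * slope2_series).
  by rewrite divr_ge0 ?mulr_ge0 ?invr_ge0 ?exprn_ge0 ?(ltW t0) ?(ltW s0).
have := ler_wpM2r ti (slope_le2 q2 R (lvl z - i)); rewrite /coefficient exprVn mulr1.
lra.
Qed.

(** On the diagonal all terms are nonnegative, so the term of the parent of [x]
    alone gives the bound; the root has only the constant. *)
Lemma tree_kernel_diag x :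
  Num.min mass^-1 (2 * slope2_series)^-1 * t^-1 ^+ lvl x <= tree_kernel x x.
Proof.
have mode_ge i : (i < lvl x)%N -> 2^-1 <= mode (anc i.+1 x) x.
  move=> ix; rewrite (mode_above T) ?(anc_neq_root T) ?(above_anc T) // par_anc //.
  rewrite /green (above_anc T) // -[leLHS]mul1r.
  apply: ler_pM; rewrite ?slope_ge1 //.
  have Q2 : (2 : R) <= (size (ch (anc i x)))%:R.
    by rewrite ler_nat (size_ch T) (leq_trans q2) // leq_addr.
  have : (size (ch (anc i x)))%:R^-1 <= (2 : R)^-1.
    by rewrite lef_pV2 ?posrE // (lt_le_trans _ Q2).
  lra.
have le0 i : (i < lvl x)%N -> 0 <= coefficient i (lvl x) * mode (anc i.+1 x) x.
  move=> ix; rewrite mulr_ge0 ?coefficient_ge0 //.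
  by apply: le_trans (mode_ge i ix); rewrite invr_ge0.
rewrite /tree_kernel; case: (lvl x) mode_ge le0 => [|n] mode_ge le0.
  by rewrite big_ord0 addr0 expr0 mulr1 ge_min lexx.
rewrite big_ord_recr /=; set S := \sum_(i < n) _.
have S0 : 0 <= S by apply: sumr_ge0 => i _; apply: le0; rewrite ltnS ltnW.
have : (2 * slope2_series)^-1 * t^-1 ^+ n.+1 <=
    coefficient n n.+1 * mode (anc n.+1 x) x.
  have -> : (2 * slope2_series)^-1 * t^-1 ^+ n.+1 = coefficient n n.+1 * 2^-1.
    rewrite /coefficient subSnn slopeS // slope0 exprVn exprS; field.
    by rewrite Qn0 (gt_eqF s0) tn0 expf_neq0.
  by rewrite ler_wpM2l ?coefficient_ge0 // mode_ge.
have tn : 0 <= t^-1 ^+ n.+1 by rewrite exprn_ge0 ?invr_ge0 ?(ltW t0).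
have : Num.min mass^-1 (2 * slope2_series)^-1 * t^-1 ^+ n.+1 <=
    (2 * slope2_series)^-1 * t^-1 ^+ n.+1.
  by rewrite ler_wpM2r // ge_min lexx orbT.
have : 0 < mass^-1 by rewrite invr_gt0.
lra.
Qed.

Lemma tree_kernel_diag_gt0 : 0 < Num.min mass^-1 (2 * slope2_series)^-1.
Proof. by rewrite lt_min !invr_gt0 mulr_gt0 // m0. Qed.

Lemma tree_kernel_bounded z : exists M, forall x, `|tree_kernel z x| <= M.
Proof.
exists (mass^-1 + \sum_(i < lvl z) coefficient i (lvl z) * 2) => x.
apply: le_trans (ler_normD _ _) _.
rewrite ger0_norm ?invr_ge0 ?(ltW m0) // lerD2l.
apply: le_trans (ler_norm_sum _ _ _) _; apply: ler_sum => i _.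
rewrite normrM ger0_norm ?coefficient_ge0 // ler_wpM2l ?coefficient_ge0 //.
apply: le_trans (mode_le T q2 R x (anc_neq_root T (ltn_ord i))) _.
by case: above; rewrite ?mulr1 ?mulr0.
Qed.

End Reproducing.

(** * Identification of the Bergman kernel *)

Local Open Scope complex_scope.

Section Complex.
Variable R : realType.
Implicit Types (z w : R[i]) (x : R).
Local Notation Re := complex.Re.
Local Notation Im := complex.Im.
Local Notation normc := Normc.normc.

Lemma normc_ge0 z : 0 <= normc z.
Proof. by case: z => a b; exact: sqrtr_ge0. Qed.

Lemma normcR x : normc x%:C = `|x|.
Proof. by rewrite /normc /= expr0n addr0 sqrtr_sqr. Qed.

Lemma normRe_le z : `|Re z| <= normc z.
Proof.
by case: z => a b /=; rewrite -sqrtr_sqr ler_wsqrtr // lerDl sqr_ge0.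
Qed.

Lemma normIm_le z : `|Im z| <= normc z.
Proof.
by case: z => a b /=; rewrite -sqrtr_sqr ler_wsqrtr // lerDr sqr_ge0.
Qed.

Lemma normc_le z : normc z <= `|Re z| + `|Im z|.
Proof.
case: z => a b /=; rewrite -[leRHS]ger0_norm ?addr_ge0 // -sqrtr_sqr ler_wsqrtr //.
rewrite -(real_normK (num_real a)) -(real_normK (num_real b)) sqrrD.
by rewrite addrAC lerDl mulrn_wge0 // mulr_ge0.
Qed.

Lemma ReM_real z x : Re (z * x%:C) = Re z * x.
Proof. by case: z => a b /=; rewrite mulr0 subr0. Qed.

Lemma ImM_real z x : Im (z * x%:C) = Im z * x.
Proof. by case: z => a b /=; rewrite mulr0 add0r. Qed.

Lemma ReD z w : Re (z + w) = Re z + Re w.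
Proof. by case: z; case: w. Qed.

Lemma ImD z w : Im (z + w) = Im z + Im w.
Proof. by case: z; case: w. Qed.

Lemma Re_sum (I : Type) (s : seq I) (F : I -> R[i]) :
  Re (\sum_(i <- s) F i) = \sum_(i <- s) Re (F i).
Proof. by elim/big_rec2: _ => // i y z _ <-; rewrite ReD. Qed.

Lemma Im_sum (I : Type) (s : seq I) (F : I -> R[i]) :
  Im (\sum_(i <- s) F i) = \sum_(i <- s) Im (F i).
Proof. by elim/big_rec2: _ => // i y z _ <-; rewrite ImD. Qed.

End Complex.

Lemma powR_gt1 (R : realType) (q x : R) : 1 < q -> (1 < q `^ x) = (0 < x).
Proof.
move=> q1; have q0 : 0 < q by apply: lt_trans q1.
by rewrite /powR gt_eqF // expR_gt1 pmulr_lgt0 // ln_gt0.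
Qed.

Lemma powR_lt1 (R : realType) (q x : R) : 1 < q -> (q `^ x < 1) = (x < 0).
Proof.
move=> q1; have q0 : 0 < q by apply: lt_trans q1.
by rewrite /powR gt_eqF // expR_lt1 pmulr_llt0 // ln_gt0.
Qed.

Section BergmanKernel.
Variables (R : realType) (q : nat) (X : choiceType) (E : rel X) (o : X) (c : R).
Hypotheses (q2 : (2 <= q)%N) (hX : homogeneous_tree E q) (c1 : 1 < c).
Implicit Types (f g : X -> R[i]) (u : X -> R).
Local Notation lvl := (lvl E o).
Local Notation par := (par E o).
Local Notation ch := (ch E o).
Local Notation ball := (subtree ch o).
Local Notation Q := (q%:R : R).
Let T : rooted_tree q o lvl par ch := rooted_tree_homogeneous o hX.

Lemma ball_uniq n : uniq (ball n).
Proof. exact: subtree_uniq T o n. Qed.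

Lemma ball_mono m n : (m <= n)%N -> {subset ball m <= ball n}.
Proof. by move=> mn x; rewrite !(mem_ball T) => /leq_trans; exact. Qed.

Lemma ball_cover x : exists n, x \in ball n.
Proof. by exists (lvl x).+1; rewrite (mem_ball T). Qed.

Lemma Q_gt1 : 1 < Q.
Proof. by rewrite ltr1n. Qed.

Lemma weightE (a : R) x : weight E o q a x = (Q `^ (- a)) ^+ lvl x.
Proof.
by rewrite /weight -mulNr powRrM powR_mulrn // powR_ge0.
Qed.

Lemma weight_ge0 (a : R) x : 0 <= weight E o q a x.
Proof. exact: powR_ge0. Qed.

Lemma Q_powR_lt1 (a : R) : (Q * Q `^ a < 1) = (a < -1).
Proof.
have -> : Q * Q `^ a = Q `^ (1 + a).
  by rewrite powRD ?powRr1 // pnatr_eq0 (gtn_eqF (ltnW q2)) implybT.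
by rewrite powR_lt1 ?Q_gt1 //; apply/idP/idP; lra.
Qed.

Local Notation t := (Q `^ (- c)).

Let t0 : 0 < t. Proof. by rewrite powR_gt0 // (lt_trans ltr01 Q_gt1). Qed.
Let qt1 : Q * t < 1. Proof. by rewrite Q_powR_lt1 ltrN2. Qed.

Local Notation K := (tree_kernel q o lvl par ch t).

Lemma harmonic_Re f : Defs.harmonic E q f ->
  real_harmonic q o par ch (fun x => complex.Re (f x)).
Proof.
move=> hf v; rewrite /laplacian.
have : \sum_(u <- ch v) f u + (if v == o then 0 else f (par v)) =
    f v * (q.+1%:R : R)%:C.
  rewrite -(sum_neighbours o hX) (hf v) rmorph_nat mulrAC mulVf ?mul1r //.
move/(congr1 (@complex.Re R)); rewrite ReM_real ReD Re_sum.
by case: ifP => _ /= e; rewrite [X in X - _]e mulrC subrr.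
Qed.

Lemma harmonic_Im f : Defs.harmonic E q f ->
  real_harmonic q o par ch (fun x => complex.Im (f x)).
Proof.
move=> hf v; rewrite /laplacian.
have : \sum_(u <- ch v) f u + (if v == o then 0 else f (par v)) =
    f v * (q.+1%:R : R)%:C.
  rewrite -(sum_neighbours o hX) (hf v) rmorph_nat mulrAC mulVf ?mul1r //.
move/(congr1 (@complex.Im R)); rewrite ImM_real ImD Im_sum.
by case: ifP => _ /= e; rewrite [X in X - _]e mulrC subrr.
Qed.

Lemma harmonic_real u : real_harmonic q o par ch u ->
  Defs.harmonic E q (fun x => (u x)%:C).
Proof.
move=> hu v; rewrite (sum_neighbours o hX).
have -> : (if v == o then 0 else (u (par v))%:C) =
    (if v == o then 0 else u (par v))%:C by case: ifP.
rewrite -rmorph_sum -rmorphD /=.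
have -> : \sum_(w <- ch v) u w + (if v == o then 0 else u (par v)) =
    q.+1%:R * u v by apply/eqP; rewrite -subr_eq0; apply/eqP; exact: hu.
by rewrite rmorphM rmorph_nat mulrA mulVf ?mul1r //.
Qed.

Lemma sum_ball_weight_le N : \sum_(x <- ball N) weight E o q c x <= mass o ch t.
Proof.
under eq_bigr do rewrite weightE; rewrite (sum_ball_pow T).
apply: nondecreasing_cvgn_le; last exact: (is_cvg_mass_sum T q2 t0 qt1).
apply/nondecreasing_seqP => n; rewrite /mass_sum big_ord_recr /= lerDl.
by rewrite mulr_ge0 ?exprn_ge0 // ltW.
Qed.

Lemma inLp_sum_le (alpha p : R) f : inLp E o q alpha p f ->
  forall N, \sum_(x <- ball N) Normc.normc (f x) `^ p * weight E o q alpha x <=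
    fine (Lp_esum E o q alpha p f).
Proof.
move=> fp N; have := sum_le_esum
  (fun x => Normc.normc (f x) `^ p * weight E o q alpha x) (ball_uniq N).
rewrite -[esum _ _]/(Lp_esum E o q alpha p f).
move=> h; rewrite -lee_fin fineK // ge0_fin_numE //.
by apply: esum_ge0 => x _; rewrite lee_fin mulr_ge0 ?powR_ge0.
Qed.

Lemma bergman_kernel_in z : bergman E o q c (fun x => (K z x)%:C).
Proof.
split; first by apply: harmonic_real; exact: laplacian_kernel.
have [M KM] := tree_kernel_bounded T q2 t0 qt1 z.
have M0 : 0 <= M by apply: le_trans (KM o).
apply: le_lt_trans (ltry (M ^+ 2 * mass o ch t)).
apply: (@esum_le_exhaust R X ball ball_uniq ball_mono ball_cover
  (fun x => Normc.normc (K z x)%:C `^ 2 * weight E o q c x)) => [x|N].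
  by rewrite mulr_ge0 ?powR_ge0.
apply: le_trans (_ : _ <= \sum_(x <- ball N) M ^+ 2 * weight E o q c x) _.
  apply: ler_sum => x _; rewrite ler_wpM2r ?weight_ge0 //.
  by rewrite normcR powR_mulrn // lerXn2r ?nnegrE.
by rewrite -mulr_sumr ler_wpM2l ?exprn_ge0 // sum_ball_weight_le.
Qed.

(** Absolute convergence follows from [2 v <= v ^+ 2 + 1], as the kernel is
    bounded in its second variable and the weight has finite mass. *)
Lemma rsum_kernel (u v : X -> R) z (M : R) :
  real_harmonic q o par ch u -> (forall x, `|u x| <= v x) ->
  (forall N, \sum_(x <- ball N) v x ^+ 2 * weight E o q c x <= M) ->
  rsum (fun x => u x * K z x * weight E o q c x) = u z.
Proof.
move=> hu uv vM; have [B KB] := tree_kernel_bounded T q2 t0 qt1 z.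
have B0 : 0 <= B by apply: le_trans (KB o).
have bnd N : \sum_(x <- ball N) `|u x * K z x * weight E o q c x| <=
    B * (M + mass o ch t).
  apply: le_trans (_ : _ <= \sum_(x <- ball N)
      (B * (v x ^+ 2 * weight E o q c x) + B * weight E o q c x)) _.
    apply: ler_sum => x _; rewrite !normrM (ger0_norm (weight_ge0 _ _)).
    rewrite mulrA -mulrDl ler_wpM2r ?weight_ge0 //.
    have v0 : 0 <= v x by apply: le_trans (uv x).
    apply: le_trans (ler_pM _ _ (uv x) (KB x)) _ => //.
    by rewrite mulrC -[X in _ + X]mulr1 -mulrDr ler_wpM2l //; nra.
  rewrite big_split /= -!mulr_sumr -mulrDr ler_wpM2l // lerD //.
  exact: sum_ball_weight_le.
have h := rsum_cvg ball_uniq ball_mono ball_cover bnd.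
apply: (cvg_unique _ h) => //.
have -> : (fun N => \sum_(x <- ball N) u x * K z x * weight E o q c x) =
    (fun N => \sum_(x <- ball N) u x * K z x * t ^+ lvl x).
  by apply/funext => N; under eq_bigr do rewrite weightE.
exact: sum_ball_kernel_cvg.
Qed.

Lemma bergman_kernelE : bergman_kernel E o q c = K.
Proof.
have KR : reproducing_kernel E o q c K.
  split=> [|g z [hg gL]]; first exact: bergman_kernel_in.
  have gM N : \sum_(x <- ball N) Normc.normc (g x) ^+ 2 * weight E o q c x <=
      fine (Lp_esum E o q c 2 g).
    apply: le_trans (inLp_sum_le gL N); apply: ler_sum => x _.
    by rewrite powR_mulrn ?normc_ge0.
  rewrite /csum; apply/eqP; rewrite eq_complex /=; apply/andP; split; apply/eqP.
    rewrite -(rsum_kernel z (harmonic_Re hg) (fun x => normRe_le (g x)) gM).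
    by congr rsum; apply/funext => x; rewrite !ReM_real.
  rewrite -(rsum_kernel z (harmonic_Im hg) (fun x => normIm_le (g x)) gM).
  by congr rsum; apply/funext => x; rewrite !ImM_real.
rewrite /bergman_kernel; apply: (reproducing_kernel_uniq _ KR).
by case: xgetP => [K' _ //|/(_ K)]; case.
Qed.

End BergmanKernel.

(** * Boundedness of operators with kernels of Bergman type *)

Section FiniteSupport.
Variables (R : realType) (X : choiceType) (B : nat -> seq X).
Hypothesis B_uniq : forall n, uniq (B n).
Hypothesis B_mono : forall m n, (m <= n)%N -> {subset B m <= B n}.
Hypothesis B_cover : forall x, exists n, x \in B n.
Implicit Types (h u : X -> R).

Lemma sum_support u M n : (forall x, x \notin B M -> u x = 0) -> (M <= n)%N ->
  \sum_(x <- B n) u x = \sum_(x <- B M) u x.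
Proof.
move=> uM Mn; rewrite (bigID (mem (B M))) /= [X in _ + X]big1 ?addr0 //.
rewrite -big_filter; apply: perm_big; apply: uniq_perm; rewrite ?filter_uniq //.
by move=> x; rewrite mem_filter; apply: andb_idr => /(B_mono Mn).
Qed.

Lemma cvg_support u M : (forall x, x \notin B M -> u x = 0) ->
  (\sum_(x <- B n) u x @[n --> \oo] --> \sum_(x <- B M) u x)%classic.
Proof.
move=> uM; apply: cvg_near_cst; exists M => // n /= Mn.
exact: sum_support.
Qed.

Lemma rsum_support u M : (forall x, x \notin B M -> u x = 0) ->
  rsum u = \sum_(x <- B M) u x.
Proof.
move=> uM; have bnd n : \sum_(x <- B n) `|u x| <= \sum_(x <- B M) `|u x|.
  rewrite -(@sum_support (fun x => `|u x|) M (maxn M n)) ?leq_maxl //.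
    by apply: ler_sum_subset => //; apply: B_mono; rewrite leq_maxr.
  by move=> x /uM ->; rewrite normr0.
exact: (cvg_unique _ (rsum_cvg B_uniq B_mono B_cover bnd) (cvg_support uM)).
Qed.

Lemma esum_support h M : (forall x, 0 <= h x) ->
  (forall x, x \notin B M -> h x = 0) ->
  esum setT (fun x => (h x)%:E) = (\sum_(x <- B M) h x)%:E.
Proof. by move=> h0 hM; apply: (esum_cvg B_uniq) => //; exact: cvg_support. Qed.

End FiniteSupport.

Lemma csum_real (R : realType) (X : choiceType) (u : X -> R) :
  csum (fun x => (u x)%:C) = (rsum u)%:C.
Proof.
rewrite /csum /=; congr (_ +i* _); rewrite /rsum.
rewrite (_ : (_^\+)%E = (fun=> 0%E)); last first.
  by apply/funext => x; rewrite funeposE /= maxxx.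
rewrite (_ : (_^\-)%E = (fun=> 0%E)); last first.
  by apply/funext => x; rewrite funenegE /= oppr0 maxxx.
by rewrite esum1 // sube0.
Qed.

Section Operator.
Variables (R : realType) (q : nat) (X : choiceType) (E : rel X) (o : X).
Variables (a b alpha c p : R) (k : X -> X -> R).
Hypotheses (q2 : (2 <= q)%N) (hX : homogeneous_tree E q).
Hypotheses (c1 : 1 < c) (p1 : 1 < p).
Local Notation lvl := (lvl E o).
Local Notation par := (par E o).
Local Notation ch := (ch E o).
Local Notation ball := (subtree ch o).
Local Notation generation := (generation ch).
Local Notation Q := (q%:R : R).
Local Notation w := (weight E o q).
Local Notation normc := Normc.normc.
Local Notation inLp := (inLp E o q alpha p).
Local Notation Lp_esum := (Lp_esum E o q alpha p).
Local Notation op := (kernel_op E o q k a b).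

Let T : rooted_tree q o lvl par ch := rooted_tree_homogeneous o hX.
Let buniq := ball_uniq o hX.
Let bmono := ball_mono (o := o) hX.
Let bcover := ball_cover o hX.
Let p0 : 0 < p. Proof. exact: lt_trans p1. Qed.
Let Q1 : 1 < Q. Proof. by rewrite ltr1n. Qed.
Let Q0 : 0 < Q. Proof. exact: lt_trans Q1. Qed.

Lemma weight_gt0 (s : R) x : 0 < w s x.
Proof. by rewrite powR_gt0. Qed.

Lemma weight_root (s : R) : w s o = 1.
Proof. by rewrite weightE lvl_o expr0. Qed.

Lemma Lp_esum_ge0 f : (0 <= Lp_esum f)%E.
Proof. by apply: esum_ge0 => x _; rewrite lee_fin mulr_ge0 ?powR_ge0. Qed.

(** On a real, nonnegative and finitely supported function all sums are finite, and
    the norm inequality can be raised to the power [p]. *)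
Lemma bounded_test : bounded_kernel_op E o q alpha p k a b ->
  exists2 C0, 0 <= C0 & forall (phi : X -> R) M N, (forall x, 0 <= phi x) ->
    (forall x, x \notin ball M -> phi x = 0) ->
    \sum_(z <- ball N)
      `|w a z * \sum_(x <- ball M) k z x * phi x * w b x| `^ p * w alpha z <=
    C0 * \sum_(x <- ball M) phi x `^ p * w alpha x.
Proof.
(* The bound given by the hypothesis need not be nonnegative. *)
move=> [C hC]; exists (Num.max C 0 `^ p); first exact: powR_ge0.
move=> phi M N phi0 phiM.
have eL : Lp_esum (fun x => (phi x)%:C) =
    (\sum_(x <- ball M) phi x `^ p * w alpha x)%:E.
  rewrite -(@esum_support _ _ _ buniq bmono bcover (fun x => phi x `^ p * w alpha x)).
  - by apply: eq_esum => x _; rewrite normcR ger0_norm.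
  - by move=> x; rewrite mulr_ge0 ?powR_ge0.
  - by move=> x /phiM ->; rewrite powR0 ?mul0r // gt_eqF.
have fL : inLp (fun x => (phi x)%:C) by rewrite /Defs.inLp eL ltry.
have [_ TL TN] := hC _ fL.
apply: le_trans (_ : _ <= fine (Lp_esum (op (fun x => (phi x)%:C)))) _.
  apply: le_trans (inLp_sum_le hX TL N); apply: ler_sum => z _.
  rewrite ler_wpM2r ?weight_ge0 // le_eqVlt; apply/orP; left; apply/eqP.
  congr (_ `^ _); rewrite /kernel_op.
  rewrite (_ : csum _ = (\sum_(x <- ball M) k z x * phi x * w b x)%:C).
    by rewrite -rmorphM normcR.
  rewrite -(rsum_support buniq bmono bcover (u := fun x => k z x * phi x * w b x)).
    by rewrite -csum_real; congr csum; apply/funext => x; rewrite -!rmorphM.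
  by move=> x /phiM ->; rewrite mulr0 mul0r.
move: TN; rewrite /Lp_norm eL /=.
set A := fine _; set B := \sum_(x <- ball M) _ => TN.
have A0 : 0 <= A by rewrite fine_ge0 // Lp_esum_ge0.
have B0 : 0 <= B by apply: sumr_ge0 => x _; rewrite mulr_ge0 ?powR_ge0.
have rootK (y : R) : 0 <= y -> y = (y `^ p^-1) `^ p.
  by move=> y0; rewrite -powRrM mulVf ?gt_eqF // powRr1.
rewrite (rootK A A0) [X in _ * X](rootK B B0).
rewrite -powRM ?powR_ge0 ?le_max ?lexx ?orbT //.
apply: ge0_ler_powR;
  rewrite ?nnegrE ?mulr_ge0 ?powR_ge0 ?le_max ?lexx ?orbT ?(ltW p0) //.
by apply: le_trans TN _; rewrite ler_wpM2r ?powR_ge0 // le_max lexx.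
Qed.

Lemma bounded_point : bounded_kernel_op E o q alpha p k a b ->
  exists2 C0, 0 <= C0 & forall y N, \sum_(z <- ball N)
      `|w a z * (k z y * w b y)| `^ p * w alpha z <= C0 * w alpha y.
Proof.
case/bounded_test => C0 C00 hC; exists C0 => // y N.
have [M yM] := bcover y.
pose phi x : R := (x == y)%:R.
have sum1 (F : X -> R) : \sum_(x <- ball M) F x * phi x = F y.
  rewrite (bigD1_seq y) //= /phi eqxx mulr1 big1 ?addr0 // => x xy.
  by rewrite (negPf xy) mulr0.
have eR : \sum_(x <- ball M) phi x `^ p * w alpha x = w alpha y.
  rewrite -[RHS]sum1; apply: eq_bigr => x _; rewrite mulrC /phi.
  case: eqP => _; rewrite ?mulr1n ?mulr0n; first by rewrite powR1.
  by rewrite powR0 // gt_eqF.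
have eL z : \sum_(x <- ball M) k z x * phi x * w b x = k z y * w b y.
  by rewrite -(sum1 (fun x => k z x * w b x)); apply: eq_bigr => x _; ring.
have := hC phi M N; rewrite eR; under eq_bigr do rewrite eL.
apply=> x; first by rewrite /phi.
by move=> xM; rewrite /phi; case: eqP xM => // ->; rewrite yM.
Qed.

Variables (kappa kappa' C : R).
Hypotheses (kappa_gt0 : 0 < kappa) (kappa'_gt0 : 0 < kappa') (C_ge0 : 0 <= C).
Hypothesis k_rootl : forall x, k o x = kappa.
Hypothesis k_rootr : forall x, k x o = kappa.
Hypothesis k_diag : forall x, kappa' * (Q `^ c) ^+ lvl x <= k x x.
Hypothesis k_le : forall z x, `|k z x| <= C * confluence lvl par (Q `^ c) z x.

Lemma sum_ball_pow_ge (s : R) N : 0 <= s -> 1 <= Q * s ->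
  N%:R <= \sum_(x <- ball N) s ^+ lvl x.
Proof.
have -> : N%:R = \sum_(d < N) (1 : R) by rewrite sumr_const card_ord.
move=> s0 Qs; rewrite sum_subtree.
apply: ler_sum => d _; rewrite (sum_generation_pow T) (lvl_root T) add0n.
apply: le_trans (_ : _ <= (Q * s) ^+ d) _; first by rewrite exprn_ege1.
rewrite exprMn ler_wpM2r ?exprn_ge0 // -natrX ler_nat; exact: size_generation_ge T o d.
Qed.

Lemma sum_ball_pow_le (N : nat) : \sum_(x <- ball N) Q^-1 ^+ lvl x <= 2 * N%:R.
Proof.
have -> : N%:R = \sum_(d < N) (1 : R) by rewrite sumr_const card_ord.
rewrite sum_subtree mulr_sumr.
apply: ler_sum => d _; rewrite (sum_generation_pow T) (lvl_root T) add0n mulr1.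
rewrite exprVn ler_pdivrMr ?exprn_gt0 // -natrX -natrM ler_nat.
by apply: (size_generation_le T); exact: ltnW.
Qed.

Lemma powRX (y s : R) n : 0 <= y -> (y ^+ n) `^ s = (y `^ s) ^+ n.
Proof.
by move=> y0; rewrite -powR_mulrn // -powRrM mulrC powRrM powR_mulrn ?powR_ge0.
Qed.

Lemma unbounded_nat (y : R) : exists n, y < n%:R.
Proof.
by exists (Num.bound `|y|); apply: le_lt_trans (ler_norm y) (archi_boundP _).
Qed.

Lemma unbounded_pow (s y : R) : 1 < s -> exists n, y < s ^+ n.
Proof.
move=> s1; have [n hn] := unbounded_nat (y / (s - 1)); exists n.
apply: lt_le_trans (_ : n%:R * (s - 1) <= _).
  by rewrite -ltr_pdivrMr // subr_gt0.
elim: n {hn} => [|n IH]; first by rewrite mul0r expr0.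
have : 1 <= s ^+ n by rewrite exprn_ege1 // ltW.
rewrite exprS -natr1; nra.
Qed.

(** The point mass at [o] is mapped to a multiple of [q ^ (- a |z|)]. *)
Lemma bounded_imp_a : bounded_kernel_op E o q alpha p k a b -> - (p * a) < alpha - 1.
Proof.
case/bounded_point => C0 C00 hC; rewrite ltNge; apply/negP => h.
pose s := Q `^ (- (a * p) - alpha).
have Qs : 1 <= Q * s.
  by rewrite leNgt (Q_powR_lt1 q2) -leNgt; lra.
have [n hn] := unbounded_nat (C0 / kappa `^ p).
have kp : 0 < kappa `^ p by rewrite powR_gt0.
have := hC o n; rewrite !weight_root !mulr1.
rewrite (eq_bigr (fun z => kappa `^ p * s ^+ lvl z)) => [|z _]; last first.
  rewrite k_rootr mulr1 ger0_norm ?mulr_ge0 ?weight_ge0 ?(ltW kappa_gt0) //.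
  rewrite powRM ?weight_ge0 ?(ltW kappa_gt0) // !weightE powRX ?powR_ge0 //.
  rewrite -powRrM mulrAC mulrC -exprMn; congr (_ * _ ^+ _).
  by rewrite -powRD ?mulNr // (gt_eqF Q0) implybT.
rewrite -mulr_sumr => h1.
have := ler_wpM2l (ltW kp) (sum_ball_pow_ge n (powR_ge0 _ _) Qs).
rewrite ltr_pdivrMr // in hn; lra.
Qed.

(** For the point mass at [x], the value of the image at [x] alone forces
    [q ^ ((c - a - b) |x|)] to stay bounded. *)
Lemma bounded_imp_c : bounded_kernel_op E o q alpha p k a b -> c <= a + b.
Proof.
case/bounded_point => C0 C00 hC; rewrite leNgt; apply/negP => h.
have s1 : 1 < Q `^ (c - a - b) by rewrite powR_gt1 //; lra.
set s := Q `^ _ in s1.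
have [n hn] := unbounded_pow ((1 + C0) / kappa') s1.
have [x xn] : exists x, lvl x = n.
  have : (0 < size (generation o n))%N.
    by apply: leq_trans (size_generation_ge T o n); rewrite expn_gt0 (ltnW q2).
  case E1 : (generation o n) => [|x l] // _; exists x.
  have := mem_head x l; rewrite -E1 (mem_generation T) (lvl_root T).
  by move=> /andP[/eqP -> _].
have [N xN] := bcover x.
have wa := weight_gt0 alpha x.
have : `|w a x * (k x x * w b x)| `^ p * w alpha x <= C0 * w alpha x.
  apply: le_trans (hC x N); rewrite (bigD1_seq x) //= lerDl.
  by apply: sumr_ge0 => z _; rewrite mulr_ge0 ?powR_ge0 ?weight_ge0.
rewrite ler_pM2r // => hx.
have yk : kappa' * s ^+ n <= `|w a x * (k x x * w b x)|.
  apply: le_trans (ler_norm _).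
  have -> : s ^+ n = (Q `^ c) ^+ lvl x * (w a x * w b x).
    rewrite !weightE xn -!exprMn; congr (_ ^+ _).
    by rewrite -!powRD ?(gt_eqF Q0) ?implybT //; congr (_ `^ _); ring.
  have := ler_wpM2r (mulr_ge0 (weight_ge0 q E o a x) (weight_ge0 q E o b x)) (k_diag x).
  have -> : w a x * (k x x * w b x) = k x x * (w a x * w b x) by ring.
  by rewrite !mulrA.
rewrite ltr_pdivrMr // mulrC in hn.
have y1 : 1 + C0 < `|w a x * (k x x * w b x)| by apply: lt_le_trans hn yk.
have : `|w a x * (k x x * w b x)| <= `|w a x * (k x x * w b x)| `^ p.
  by apply: le1r_powR (ltW p1); lra.
lra.
Qed.

(** On the ball of radius [M], the test function [q ^ (|x| (alpha - 1) / p)] has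
    [p]-th power of the norm at most [2 * M], whereas the image would have value
    at least [kappa * M] at [o] if [p * (b - 1) <= alpha - 1]. *)
Lemma bounded_imp_b : bounded_kernel_op E o q alpha p k a b -> alpha - 1 < p * (b - 1).
Proof.
case/bounded_test => C0 C00 hC; rewrite ltNge; apply/negP => h.
have kp : 0 < kappa `^ p by rewrite powR_gt0.
have [M hM] := unbounded_nat (1 + (2 * C0 / kappa `^ p) `^ (p - 1)^-1).
pose e := Q `^ ((alpha - 1) / p).
pose phi x : R := if x \in ball M then e ^+ lvl x else 0.
have e0 : 0 <= e by exact: powR_ge0.
have phi0 x : 0 <= phi x by rewrite /phi; case: ifP => // _; rewrite exprn_ge0.
have := hC phi M 1%N phi0 (fun x xM => ifN _ _ xM).
rewrite (_ : ball 1 = [:: o]) // big_seq1 !weight_root mul1r mulr1.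
have pe : (alpha - 1) / p * p = alpha - 1 by field; rewrite gt_eqF.
rewrite (eq_big_seq (fun x => kappa * (e * Q `^ (- b)) ^+ lvl x)) => [|x xM]; last first.
  by rewrite k_rootl /phi xM weightE exprMn mulrA.
rewrite [X in _ <= _ * X](eq_big_seq (fun x => Q^-1 ^+ lvl x)) => [|x xM]; last first.
  rewrite /phi xM weightE powRX // -exprMn -powRrM pe; congr (_ ^+ _).
  rewrite -powRD ?(gt_eqF Q0) ?implybT // -(@powR_inv1 _ Q) ?(ltW Q0) //.
  by congr (_ `^ _); ring.
have S0 : 0 <= \sum_(x <- ball M) (e * Q `^ (- b)) ^+ lvl x.
  by apply: sumr_ge0 => x _; rewrite exprn_ge0 // mulr_ge0 ?powR_ge0.
rewrite -mulr_sumr ger0_norm ?mulr_ge0 ?(ltW kappa_gt0) //.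
rewrite powRM ?(ltW kappa_gt0) // => h1.
have Qe : 1 <= Q * (e * Q `^ (- b)).
  rewrite -powRD ?(gt_eqF Q0) ?implybT // leNgt (Q_powR_lt1 q2) -leNgt.
  suff : b - 1 <= (alpha - 1) / p by lra.
  by rewrite ler_pdivlMr // mulrC.
have h2 : M%:R `^ p <= (\sum_(x <- ball M) (e * Q `^ (- b)) ^+ lvl x) `^ p.
  have h3 := sum_ball_pow_ge M (mulr_ge0 e0 (powR_ge0 _ _)) Qe.
  by apply: ge0_ler_powR; rewrite ?nnegrE ?(ltW p0) ?ler0n.
have D0 : 0 <= 2 * C0 / kappa `^ p by rewrite divr_ge0 ?mulr_ge0 ?powR_ge0.
have M0 : (0 : R) < M%:R by apply: le_lt_trans hM; rewrite addr_ge0 ?powR_ge0.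
have h4 : M%:R `^ (p - 1) <= 2 * C0 / kappa `^ p.
  rewrite ler_pdivlMr // -(ler_pM2l M0) !mulrA mulr_powRB1 ?(ltW M0) //.
  have := ler_wpM2l C00 (sum_ball_pow_le M).
  have := ler_wpM2l (ltW kp) h2; lra.
have pp : 0 < p - 1 by rewrite subr_gt0.
have : (M%:R `^ (p - 1)) `^ (p - 1)^-1 <= (2 * C0 / kappa `^ p) `^ (p - 1)^-1.
  by apply: ge0_ler_powR; rewrite ?nnegrE ?powR_ge0 ?invr_ge0 ?(ltW pp).
rewrite -powRrM divff ?gt_eqF // powRr1 ?(ltW M0) //; lra.
Qed.

(** The conditions on [tau] are [- a < tau < b - 1] and
    [alpha - b < tau * (p - 1) < a + alpha - 1].  Each interval is nonempty because
    [a + b >= c > 1], and the mixed comparisons of endpoints are the two inequalities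
    of the second hypothesis. *)
Lemma schur_exponent : c <= a + b -> - (p * a) < alpha - 1 < p * (b - 1) ->
  exists tau : R, [/\ - a < tau, tau < b - 1, alpha - b < tau * (p - 1) &
    tau * (p - 1) < a + alpha - 1].
Proof.
move=> cab /andP[ha hb]; have pp : 0 < p - 1 by rewrite subr_gt0.
pose L : R := Num.max (- a) ((alpha - b) / (p - 1)).
pose U : R := Num.min (b - 1) ((a + alpha - 1) / (p - 1)).
have LU : L < U.
  have h1 : - a < b - 1 by have := c1; lra.
  have h2 : (alpha - b) / (p - 1) < b - 1 by rewrite ltr_pdivrMr //; nra.
  have h3 : - a < (a + alpha - 1) / (p - 1) by rewrite ltr_pdivlMr //; nra.
  have h4 : (alpha - b) / (p - 1) < (a + alpha - 1) / (p - 1).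
    by rewrite ltr_pM2r ?invr_gt0 //; lra.
  by rewrite /L /U lt_min !gt_max h1 h2 h3 h4.
have L1 : - a <= L by rewrite le_max lexx.
have L2 : (alpha - b) / (p - 1) <= L by rewrite le_max lexx orbT.
have U1 : U <= b - 1 by rewrite ge_min lexx.
have U2 : U <= (a + alpha - 1) / (p - 1) by rewrite ge_min lexx orbT.
exists ((L + U) / 2); split; first lra; first lra.
- rewrite -ltr_pdivrMr //; lra.
- rewrite -ltr_pdivlMr //; lra.
Qed.

Let H z x : R := w a z * `|k z x| * w b x.

Let H_ge0 z x : 0 <= H z x.
Proof. by rewrite !mulr_ge0 ?weight_ge0. Qed.

Lemma powRDn (x y : R) n : (Q `^ x) ^+ n * (Q `^ y) ^+ n = (Q `^ (x + y)) ^+ n.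
Proof. by rewrite -exprMn -powRD // (gt_eqF Q0) implybT. Qed.

Lemma k_le_ab z x : c <= a + b ->
  `|k z x| <= C * confluence lvl par (Q `^ (a + b)) z x.
Proof.
move=> cab; apply: le_trans (k_le z x) _; rewrite ler_wpM2l //.
by apply: le_confluence; rewrite ?powR_ge0 // ler_powR // ltW.
Qed.

Lemma schur_finite : c <= a + b -> - (p * a) < alpha - 1 < p * (b - 1) ->
  exists2 D, 0 <= D & forall (f : X -> R) M N, (forall x, 0 <= f x) ->
    \sum_(z <- ball M) (\sum_(x <- ball N) H z x * f x) `^ p * w alpha z <=
    D * \sum_(x <- ball N) f x `^ p * w alpha x.
Proof.
move=> cab habc; have [tau [h1 h2 h3 h4]] := schur_exponent cab habc.
have conf (s : R) : s < -1 -> 0 < a + b + s -> exists2 A : R, 0 <= A &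
    forall z N, \sum_(x <- ball N)
      confluence lvl par (Q `^ (a + b)) z x * (Q `^ s) ^+ lvl x
      <= A * (Q `^ (a + b + s)) ^+ lvl z.
  move=> s1 s2.
  have e : Q `^ (a + b) * Q `^ s = Q `^ (a + b + s).
    by rewrite -powRD // (gt_eqF Q0) implybT.
  have r1 : 1 < Q `^ (a + b + s) by rewrite powR_gt1.
  have qs : Q * Q `^ s < 1 by rewrite (Q_powR_lt1 q2).
  exists (2 / (1 - Q * Q `^ s) * (Q `^ (a + b + s) / (Q `^ (a + b + s) - 1))).
    by rewrite mulr_ge0 ?divr_ge0 ?powR_ge0 ?subr_ge0 ?(ltW r1) ?(ltW qs).
  move=> z N; rewrite -!e; apply: (sum_confluence_pow T) => //; rewrite ?powR_ge0 ?e //.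
  exact: ltnW.
have [||A A0 hA] := conf (tau - b); [lra|lra|].
have [||A' A'0 hA'] := conf (tau * (p - 1) - a - alpha); [lra|lra|].
exists ((C * A) `^ (p - 1) * (C * A')); first by rewrite mulr_ge0 ?mulr_ge0 ?powR_ge0.
move=> f M N f0.
apply: (@schur_test _ _ _ _ H f (fun x => (Q `^ tau) ^+ lvl x)) => //.
- by move=> x; rewrite exprn_gt0 ?powR_gt0.
- by move=> x; exact: weight_ge0.
- by rewrite mulr_ge0.
- move=> z; apply: le_trans (_ : _ <= w a z * C * \sum_(x <- ball N)
     confluence lvl par (Q `^ (a + b)) z x * (Q `^ (tau - b)) ^+ lvl x) _.
    rewrite mulr_sumr; apply: ler_sum => x _.
    have -> : H z x * (Q `^ tau) ^+ lvl x =
        `|k z x| * (w a z * (Q `^ (tau - b)) ^+ lvl x).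
      by rewrite /H (weightE q E o b) -powRDn; ring.
    apply: le_trans (ler_wpM2r _ (k_le_ab z x cab)) _.
      by rewrite mulr_ge0 ?weight_ge0 ?exprn_ge0 ?powR_ge0.
    by rewrite le_eqVlt; apply/orP; left; apply/eqP; ring.
  apply: le_trans (ler_wpM2l _ (hA z N)) _; first by rewrite mulr_ge0 ?weight_ge0.
  rewrite (_ : a + b + (tau - b) = a + tau); last by ring.
  rewrite -powRDn weightE le_eqVlt; apply/orP; left; apply/eqP.
  have e : (Q `^ (- a)) ^+ lvl z * (Q `^ a) ^+ lvl z = 1.
    by rewrite powRDn addNr powRr0 expr1n.
  by rewrite -[RHS]mul1r -[X in _ = X * _]e; ring.
- move=> x; apply: le_trans (_ : _ <= w b x * C * \sum_(z <- ball M)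
     confluence lvl par (Q `^ (a + b)) x z *
       (Q `^ (tau * (p - 1) - a - alpha)) ^+ lvl z) _.
    rewrite mulr_sumr; apply: ler_sum => z _.
    have -> : H z x * ((Q `^ tau) ^+ lvl z) `^ (p - 1) * w alpha z =
        `|k z x| * (w b x * (Q `^ (tau * (p - 1) - a - alpha)) ^+ lvl z).
      rewrite /H (weightE q E o a) (weightE q E o alpha) powRX ?powR_ge0 // -powRrM.
      rewrite -addrA -(powRDn (tau * (p - 1)) (- a - alpha)).
      rewrite -(powRDn (- a) (- alpha)); ring.
    apply: le_trans (ler_wpM2r _ (k_le_ab z x cab)) _.
      by rewrite mulr_ge0 ?weight_ge0 ?exprn_ge0 ?powR_ge0.
    by rewrite confluenceC le_eqVlt; apply/orP; left; apply/eqP; ring.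
  apply: le_trans (ler_wpM2l _ (hA' x M)) _; first by rewrite mulr_ge0 ?weight_ge0.
  rewrite powRX ?powR_ge0 // -powRrM !weightE.
  rewrite (_ : _ + (_ - _ - _) = b + (tau * (p - 1) - alpha)); last by ring.
  rewrite -(powRDn b (tau * (p - 1) - alpha)) -(powRDn (tau * (p - 1)) (- alpha)).
  rewrite le_eqVlt; apply/orP; left; apply/eqP.
  have e : (Q `^ (- b)) ^+ lvl x * (Q `^ b) ^+ lvl x = 1.
    by rewrite powRDn addNr powRr0 expr1n.
  by rewrite -[RHS]mul1r -[X in _ = X * _]e; ring.
Qed.

(** The bounds on finite balls pass to the whole tree through the suprema [S z] of
    the partial sums.  On a finite set of vertices [z] some partial sum is at
    least half of [S z]; this loses only a constant factor. *)
Lemma imp_bounded : c <= a + b -> - (p * a) < alpha - 1 < p * (b - 1) ->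
  bounded_kernel_op E o q alpha p k a b.
Proof.
move=> cab habc; have [D D0 hD] := schur_finite cab habc.
exists ((4 `^ p * D) `^ p^-1) => f fL.
set L := fine (Lp_esum f).
have L0 : 0 <= L by rewrite fine_ge0 // Lp_esum_ge0.
pose G N z := \sum_(x <- ball N) H z x * normc (f x).
have G0 N z : 0 <= G N z by apply: sumr_ge0 => x _; rewrite mulr_ge0 ?normc_ge0.
have Gmono z M N : (M <= N)%N -> G M z <= G N z.
  move=> MN; apply: ler_sum_subset => // [|x]; first exact: bmono.
  by rewrite mulr_ge0 ?normc_ge0.
have GL M N : \sum_(z <- ball M) G N z `^ p * w alpha z <= D * L.
  apply: le_trans (hD (fun x => normc (f x)) M N (fun x => normc_ge0 (f x))) _.
  by rewrite ler_wpM2l // (inLp_sum_le hX fL).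
have Gbnd z : exists B, forall N, G N z <= B.
  have [M zM] := bcover z; exists ((D * L / w alpha z) `^ p^-1) => N.
  have : G N z `^ p <= D * L / w alpha z.
    rewrite ler_pdivlMr ?weight_gt0 //; apply: le_trans (GL M N).
    rewrite (bigD1_seq z) //= lerDl sumr_ge0 // => y _.
    by rewrite mulr_ge0 ?powR_ge0 ?weight_ge0.
  move=> h; have pi : 0 <= p^-1 by rewrite invr_ge0 ltW.
  have := ge0_ler_powR pi (powR_ge0 _ _) (le_trans (powR_ge0 _ _) h) h.
  by rewrite -powRrM divff ?gt_eqF // powRr1.
pose S z := sup (range (fun N => G N z)).
have GS z N : G N z <= S z.
  apply: sup_upper_bound; last by exists N.
  split; first by exists (G 0%N z), 0%N.
  by have [B hB] := Gbnd z; exists B => _ [n _ <-].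
have S0 z : 0 <= S z by apply: le_trans (GS z 0%N).
have S2G z : exists N, S z <= 2 * G N z.
  have [Sz|Sz] := leP (S z) 0; first by exists 0%N; rewrite (le_trans Sz) // mulr_ge0.
  have hs : has_sup (range (fun N => G N z)).
    split; first by exists (G 0%N z), 0%N.
    by have [B hB] := Gbnd z; exists B => _ [n _ <-].
  have e0 : 0 < S z / 2 by rewrite divr_gt0.
  have [_ [N _ <-] hN] := sup_adherent e0 hs.
  by exists N; move: hN; rewrite -/(S z); lra.
have S2Gs (s : seq X) : exists N, {in s, forall z, S z <= 2 * G N z}.
  elim: s => [|z s [N hN]]; first by exists 0%N.
  have [N' hN'] := S2G z; exists (maxn N' N) => y.
  rewrite inE => /predU1P[->|/hN h].
    by apply: le_trans hN' _; rewrite ler_wpM2l // Gmono // leq_maxl.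
  by apply: le_trans h _; rewrite ler_wpM2l // Gmono // leq_maxr.
have term z x : normc ((k z x)%:C * f x * (w b x)%:C) = `|k z x| * normc (f x) * w b x.
  by rewrite !Normc.normcM !normcR (ger0_norm (weight_ge0 _ _ _ _ _)).
have wa z : 0 < w a z by exact: weight_gt0.
have termS z N : \sum_(x <- ball N) normc ((k z x)%:C * f x * (w b x)%:C) <=
    S z / w a z.
  rewrite ler_pdivlMr // mulr_suml; apply: le_trans (GS z N).
  apply: ler_sum => x _; rewrite term /H le_eqVlt; apply/orP; left; apply/eqP; ring.
have opS z : normc (op f z) <= 2 * S z.
  rewrite /kernel_op Normc.normcM normcR (ger0_norm (weight_ge0 _ _ _ _ _)).
  have rS (part : R[i] -> R) : (forall v, `|part v| <= normc v) ->
      `|rsum (fun x => part ((k z x)%:C * f x * (w b x)%:C))| <= S z / w a z.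
    move=> hp; apply: (rsum_le buniq bmono bcover) => N.
    by apply: le_trans (termS z N); apply: ler_sum.
  have h1 := rS _ (@normRe_le R); have h2 := rS _ (@normIm_le R).
  have h3 := normc_le (csum (fun x => (k z x)%:C * f x * (w b x)%:C)).
  rewrite mulrC -ler_pdivlMr //; apply: le_trans h3 _.
  by rewrite /csum /= -mulrA; lra.
have TL N : \sum_(z <- ball N) normc (op f z) `^ p * w alpha z <= 4 `^ p * (D * L).
  have [M hM] := S2Gs (ball N).
  apply: le_trans (ler_wpM2l (powR_ge0 _ _) (GL N M)).
  rewrite mulr_sumr big_seq [leRHS]big_seq; apply: ler_sum => z zN.
  rewrite mulrA ler_wpM2r ?weight_ge0 // -powRM //.
  apply: ge0_ler_powR; rewrite ?nnegrE ?(ltW p0) ?normc_ge0 ?mulr_ge0 //.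
  by apply: le_trans (opS z) _; have := hM z zN; lra.
have eL : (Lp_esum (op f) <= (4 `^ p * (D * L))%:E)%E.
  apply: (@esum_le_exhaust R X ball buniq bmono bcover
    (fun z => normc (op f z) `^ p * w alpha z)) => // z.
  by rewrite mulr_ge0 ?powR_ge0 ?weight_ge0.
split=> [z||].
- apply: le_lt_trans (ltry (S z / w a z)).
  rewrite (eq_esum (b := fun x => (normc ((k z x)%:C * f x * (w b x)%:C))%:E)).
    by apply: (esum_le_exhaust buniq bmono bcover) => // x; exact: normc_ge0.
  by move=> x _; rewrite abse_EFin ger0_norm ?normc_ge0.
- exact: le_lt_trans eL (ltry _).
- rewrite /Lp_norm -/L -powRM ?mulr_ge0 ?powR_ge0 //.
  have fin : Lp_esum (op f) \is a fin_num.
    by rewrite ge0_fin_numE ?Lp_esum_ge0 // (le_lt_trans eL (ltry _)).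
  apply: ge0_ler_powR; rewrite ?nnegrE ?invr_ge0 ?(ltW p0) ?fine_ge0 ?Lp_esum_ge0 //.
    by rewrite !mulr_ge0 ?powR_ge0.
  by rewrite -lee_fin fineK // -mulrA.
Qed.

Lemma bounded_kernel_opP : bounded_kernel_op E o q alpha p k a b <->
  c <= a + b /\ - (p * a) < alpha - 1 < p * (b - 1).
Proof.
split=> [h|[cab habc]]; last exact: imp_bounded.
by rewrite bounded_imp_a // bounded_imp_b //; split=> //; exact: bounded_imp_c.
Qed.

End Operator.

(** * The two Bergman operators *)

(** The two operators differ by the sign pattern of their kernels only; both
    [K] and [`|K|] dominate [K] and have the absolute values of [K], and that is
    all the criterion uses. *)
Lemma bounded_sign_kernelP (R : realType) (q : nat) (X : choiceType) (E : rel X)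
    (o : X) (a b alpha c p : R) (k : X -> X -> R) :
  (2 <= q)%N -> homogeneous_tree E q -> 1 < c -> 1 < p ->
  (forall z x, `|k z x| = `|bergman_kernel E o q c z x|) ->
  (forall z x, bergman_kernel E o q c z x <= k z x) ->
  bounded_kernel_op E o q alpha p k a b <->
  c <= a + b /\ - (p * a) < alpha - 1 < p * (b - 1).
Proof.
move=> q2 hX c1 p1; rewrite (bergman_kernelE o q2 hX c1).
have T := rooted_tree_homogeneous o hX.
set t := (q%:R : R) `^ (- c); set K := tree_kernel _ _ _ _ _ _ => kn kK.
have t0 : 0 < t by rewrite powR_gt0 // ltr0n (ltnW q2).
have qt1 : q%:R * t < 1 by rewrite Q_powR_lt1 // ltrN2.
have tV : t^-1 = (q%:R : R) `^ c by rewrite /t powRN invrK.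
set m := (mass o (ch E o) t)^-1.
have m0 : 0 < m by rewrite invr_gt0 (lt_le_trans ltr01) ?(mass_ge1 T q2 t0 qt1).
have pos z x : K z x = m -> k z x = m.
  move=> Kzx; have := kK z x; have := kn z x; rewrite Kzx (gtr0_norm m0) => nk km.
  by rewrite -nk ger0_norm // (le_trans (ltW m0)).
have s0 : 0 < t * slope2_series q t.
  by rewrite mulr_gt0 // (lt_le_trans ltr01) // (slope2_series_ge1 q2 t0 qt1).
apply: (@bounded_kernel_opP R q X E o a b alpha c p k q2 hX c1 p1 m
  (Num.min m (2 * slope2_series q t)^-1) (m + 4 / (t * slope2_series q t))) => //.
- exact: (tree_kernel_diag_gt0 T q2 t0 qt1).
- by rewrite addr_ge0 ?divr_ge0 ?(ltW s0) // ltW.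
- by move=> x; apply: pos; exact: (tree_kernel_rootl T).
- by move=> x; apply: pos; exact: (tree_kernel_rootr T).
- move=> x; rewrite -tV; apply: le_trans (kK x x).
  exact: (tree_kernel_diag T q2 t0 qt1).
- by move=> z x; rewrite kn -tV; exact: (tree_kernel_le T q2 t0 qt1).
Qed.

Theorem theorem14 (R : realType) (q : nat) (X : choiceType) (E : rel X) (o : X)
    (a b alpha c p : R) (hq : (2 <= q)%N) (hX : homogeneous_tree E q)
    (halpha : 1 < alpha) (hc : 1 < c) (hp : 1 < p) :
  (S_bounded E o q a b c alpha p <-> T_bounded E o q a b c alpha p) /\
  (T_bounded E o q a b c alpha p <->
     c <= a + b /\ - (p * a) < alpha - 1 < p * (b - 1)).
Proof.
have S_iff : S_bounded E o q a b c alpha p <->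
    c <= a + b /\ - (p * a) < alpha - 1 < p * (b - 1).
  apply: bounded_sign_kernelP => // z x; first by rewrite normr_id.
  exact: ler_norm.
have T_iff : T_bounded E o q a b c alpha p <->
    c <= a + b /\ - (p * a) < alpha - 1 < p * (b - 1).
  exact: bounded_sign_kernelP.
by split; [apply: (iff_trans S_iff); apply: iff_sym|].
Qed.
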